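(* Let $T$ be an amenable NIP theory and let $S:=S^{\rm inv}_{\bar n}(\mathfrak C,M)$ with the $*$-product. Then: (1) $\mathrm{fGen}$ is a two-sided ideal of $(S,* )$; (2) for each $p\in\mathrm{fGen}$, $p*S=\mathrm{Aut}(\mathfrak C)\cdot p$ and this set is an Ellis group of $(S,* )$ (in particular a minimal right ideal); (3) $\mathrm{fGen}$ is the unique minimal left ideal of $(S,* )$; (4) the Ellis groups of $(S,* )$ are exactly the $\mathrm{Aut}(\mathfrak C)$-orbits of f-generic types; (5) the map $\rho:S\to\mathrm{Gal}_{\mathrm{KP}}(T)$ is injective on each Ellis group of $(S,* )$.
   Context: $T$ is a complete first-order theory, $\mathfrak C$ a monster model, $\mathfrak C'\succeq\mathfrak C$ a larger monster model. Fix small $M\preceq N\preceq\mathfrak C$ with enumerations $\bar m\subseteq\bar n$; $\bar x$ is the tuple of variables for $\bar n$. $S_{\bar n}(\mathfrak C)$ is the set of global types in $\bar x$ extending $\mathrm{tp}(\bar n/\emptyset)$; each is $\mathrm{tp}(\sigma(\bar n)/\mathfrak C)$ for some $\sigma\in\mathrm{Aut}(\mathfrak C')$. $S^{\rm inv}_{\bar n}(\mathfrak C,M)$ is the set of $M$-invariant ones; for such $p$, $p|_{\mathfrak C'}$ is its unique $M$-invariant extension to $\mathfrak C'$. The $*$-product: for $q=\mathrm{tp}(\tau(\bar n)/\mathfrak C)$, $\tau\in\mathrm{Aut}(\mathfrak C')$, $p*q:=(\tau\cdot p|_{\mathfrak C'})|_{\mathfrak C}$, i.e. $\theta(\bar x;\bar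 b)\in p*q$ iff $\theta(\bar x;\tau^{-1}(\bar b))\in p|_{\mathfrak C'}$; $(S^{\rm inv}_{\bar n}(\mathfrak C,M),* )$ is a compact Hausdorff left-continuous semigroup. An Ellis group of such a semigroup is a set $u*I$ where $I$ is a minimal left ideal and $u\in I$ is an idempotent. A type $p\in S^{\rm inv}_{\bar n}(\mathfrak C,M)$ is f-generic if its $\mathrm{Aut}(\mathfrak C)$-orbit is bounded (equivalently its stabilizer in $\mathrm{Aut}(\mathfrak C)$ equals $\mathrm{Autf}_{\mathrm{Lasc}}(\mathfrak C)$); $\mathrm{fGen}$ denotes the set of f-generic types. $T$ is amenable if there is an $\mathrm{Aut}(\mathfrak C)$-invariant Keisler measure on $S_{\bar m}(\mathfrak C)$. $\mathrm{Gal}_{\mathrm{KP}}(T)=\mathrm{Aut}(\mathfrak C')/\mathrm{Autf}_{\mathrm{KP}}(\mathfrak C')$ and $\rho(\mathrm{tp}(\sigma(\bar n)/\mathfrak C))=\sigma^{-1}\mathrm{Autf}_{\mathrm{KP}}(\mathfrak C')$ for $\sigma\in\mathrm{Aut}(\mathfrak C')$. *)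

(* Defs.v *)
From HB Require Import structures.
From mathcomp Require Import all_boot ssralg ssrnum.
From mathcomp Require Import boolp classical_sets functions cardinality reals.

Set Implicit Arguments.
Unset Strict Implicit.
Unset Printing Implicit Defensive.

Local Open Scope classical_set_scope.
Local Open Scope card_scope.

(** ** Cardinals

Cardinals are represented by types; "smaller than kappa" is a strict comparison
with the full set of a type [K]. *)

Definition card_lt (A B : Type) (X : set A) (Y : set B) : Prop :=
  X #<= Y /\ ~ (Y #<= X).

Definition small (K X : Type) : Prop := card_lt [set: X] [set: K].

(* Closure under exponentiation only: being infinite is imposed separately,
   through [|T| < kappa] in [monster]. *)
Definition strong_limit (K : Type) : Prop :=
  forall X : set K, card_lt X [set: K] -> card_lt [set Y | Y `<=` X] [set: K].

(** ** First-order logic (one-sorted)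

[formula L V] is the type of first-order formulas whose free variables are taken
in the type [V]; under a quantifier the bound variable is [None : option V].
Taking [V := I + A], one gets the formulas in the variables [(x_i)_(i : I)] with
parameters from [A]. *)

Record language := Language {
  fsym : Type; farity : fsym -> nat;
  rsym : Type; rarity : rsym -> nat }.

Inductive term (L : language) (V : Type) : Type :=
| TVar of V
| TApp (f : fsym L) of ('I_(farity f) -> term L V).

Inductive formula (L : language) (V : Type) : Type :=
| FFalse
| FEq of term L V & term L V
| FRel (r : rsym L) of ('I_(rarity r) -> term L V)
| FImp of formula L V & formula L V
| FAll of formula L (option V).

Arguments FFalse {L V}.

Definition FNot (L : language) (V : Type) (phi : formula L V) : formula L V :=
  FImp phi FFalse.

Fixpoint rename_term (L : language) (V W : Type) (f : V -> W)
    (t : term L V) : term L W :=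
  match t with
  | TVar v => TVar L (f v)
  | TApp g a => TApp (fun i => rename_term f (a i))
  end.

Fixpoint rename (L : language) (V W : Type) (f : V -> W)
    (phi : formula L V) : formula L W :=
  match phi with
  | FFalse => FFalse
  | FEq s t => FEq (rename_term f s) (rename_term f t)
  | FRel r a => FRel (fun i => rename_term f (a i))
  | FImp phi1 phi2 => FImp (rename f phi1) (rename f phi2)
  | FAll psi => FAll (rename (omap f) psi)
  end.

Record structure (L : language) := Structure {
  carrier :> Type;
  fint : forall f : fsym L, ('I_(farity f) -> carrier) -> carrier;
  rint : forall r : rsym L, ('I_(rarity r) -> carrier) -> Prop;
  carrier_inhabited : inhabited carrier }.

Arguments fint {L} s f _.
Arguments rint {L} s r _.

Fixpoint eval (L : language) (A : structure L) (V : Type) (t : term L V)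
    (v : V -> A) : A :=
  match t with
  | TVar x => v x
  | TApp f a => fint A f (fun i => eval (a i) v)
  end.

Definition env_cons (A V : Type) (a : A) (v : V -> A) : option V -> A :=
  fun o => if o is Some x then v x else a.

Definition env_sum (X Y A : Type) (v : X -> A) (w : Y -> A) : X + Y -> A :=
  fun z => match z with inl x => v x | inr y => w y end.

Fixpoint sat (L : language) (A : structure L) (V : Type) (phi : formula L V) :
    (V -> A) -> Prop :=
  match phi with
  | FFalse => fun=> False
  | FEq s t => fun v => eval s v = eval t v
  | FRel r a => fun v => rint A r (fun i => eval (a i) v)
  | FImp phi1 phi2 => fun v => sat phi1 v -> sat phi2 v
  | FAll psi => fun v => forall a : A, sat psi (env_cons a v)
  end.

Arguments sat {L} A {V} phi v.

Definition sentence (L : language) : Type := formula L void.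

Definition models (L : language) (A : structure L) (T : set (sentence L)) : Prop :=
  forall phi, T phi -> sat A phi (of_void A).

Definition complete_theory (L : language) (T : set (sentence L)) : Prop :=
  (exists A : structure L, models A T) /\
  forall phi : sentence L,
    (forall A : structure L, models A T -> sat A phi (of_void A)) \/
    (forall A : structure L, models A T -> sat A (FNot phi) (of_void A)).

Definition NIP_formula (L : language) (A : structure L) (m n : nat)
    (phi : formula L ('I_m + 'I_n)) : Prop :=
  ~ exists (a : nat -> 'I_m -> A) (b : set nat -> 'I_n -> A),
      forall i X, sat A phi (env_sum (a i) (b X)) <-> X i.

Definition NIP (L : language) (T : set (sentence L)) : Prop :=
  forall A : structure L, models A T ->
  forall (m n : nat) (phi : formula L ('I_m + 'I_n)), NIP_formula A phi.

(* Only the values of [f] on [D] matter. *)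
Definition elementary_on (L : language) (A B : structure L) (D : set A)
    (f : A -> B) : Prop :=
  forall (n : nat) (phi : formula L 'I_n) (a : 'I_n -> A),
    (forall i, D (a i)) -> (sat A phi a <-> sat B phi (f \o a)).

Definition elementary (L : language) (A B : structure L) (f : A -> B) : Prop :=
  elementary_on [set: A] f.

(** ** Automorphisms *)

Record aut (L : language) (A : structure L) := Aut {
  aut_fun :> A -> A;
  aut_invfun : A -> A;
  aut_funK : cancel aut_fun aut_invfun;
  aut_invfunK : cancel aut_invfun aut_fun;
  aut_fint : forall f a, aut_fun (fint A f a) = fint A f (aut_fun \o a);
  aut_rint : forall r a, rint A r (aut_fun \o a) <-> rint A r a }.

Arguments aut_fint {L A} g f a : rename.
Arguments aut_rint {L A} g r a : rename.

HB.instance Definition _ (L : language) (A : structure L) :=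
  gen_eqMixin (aut A).
HB.instance Definition _ (L : language) (A : structure L) :=
  gen_choiceMixin (aut A).

Definition aut_one (L : language) (A : structure L) : aut A :=
  @Aut L A id id (fun=> erefl) (fun=> erefl) (fun _ _ => erefl)
    (fun _ _ => iff_refl _).

Lemma aut_inv_fint (L : language) (A : structure L) (g : aut A) f a :
  aut_invfun g (fint A f a) = fint A f (aut_invfun g \o a).
Proof.
rewrite -[RHS](aut_funK g) aut_fint; congr (aut_invfun g (fint A f _)).
by apply/funext => i /=; rewrite aut_invfunK.
Qed.

Lemma aut_inv_rint (L : language) (A : structure L) (g : aut A) r a :
  rint A r (aut_invfun g \o a) <-> rint A r a.
Proof.
rewrite -(aut_rint g r (aut_invfun g \o a)).
suff -> : g \o (aut_invfun g \o a) = a by [].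
by apply/funext => i /=; rewrite aut_invfunK.
Qed.

Definition aut_inv (L : language) (A : structure L) (g : aut A) : aut A :=
  Aut (aut_invfunK g) (aut_funK g) (aut_inv_fint g) (aut_inv_rint g).

Lemma aut_mul_fint (L : language) (A : structure L) (g h : aut A) f a :
  (g \o h) (fint A f a) = fint A f ((g \o h) \o a).
Proof. by rewrite /= !aut_fint. Qed.

Lemma aut_mul_rint (L : language) (A : structure L) (g h : aut A) r a :
  rint A r ((g \o h) \o a) <-> rint A r a.
Proof. by rewrite -(aut_rint h r a) -(aut_rint g r (h \o a)). Qed.

Definition aut_mul (L : language) (A : structure L) (g h : aut A) : aut A :=
  Aut (can_comp (aut_funK g) (aut_funK h))
    (can_comp (aut_invfunK h) (aut_invfunK g))
    (aut_mul_fint g h) (aut_mul_rint g h).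

Definition left_coset (L : language) (A : structure L) (g : aut A)
    (H : set (aut A)) : set (aut A) :=
  [set aut_mul g h | h in H].

(** ** Monster models *)

Definition saturated (L : language) (K : Type) (C : structure L) : Prop :=
  forall D : set C, card_lt D [set: K] ->
  forall Sigma : set (formula L (unit + D)),
    (forall (n : nat) (phi : 'I_n -> formula L (unit + D)),
       (forall i, Sigma (phi i)) ->
       exists c : C, forall i, sat C (phi i) (env_sum (fun=> c) set_val)) ->
    exists c : C, forall phi, Sigma phi -> sat C phi (env_sum (fun=> c) set_val).

Definition strongly_homogeneous (L : language) (K : Type) (C : structure L) : Prop :=
  forall D : set C, card_lt D [set: K] ->
  forall f : C -> C, elementary_on D f ->
    exists g : aut C, forall d, D d -> g d = f d.

(* [|T|] is the number of formulas in countably many variables. *)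
Record monster (L : language) (K : Type) (C : structure L) : Prop := Monster {
  monster_strong_limit : strong_limit K;
  monster_card : small K (formula L nat);
  monster_saturated : saturated K C;
  monster_homogeneous : strongly_homogeneous K C }.

(** ** Types *)

Definition reparam (L : language) (I A B : Type) (f : A -> B)
    (theta : formula L (I + A)) : formula L (I + B) :=
  rename (env_sum inl (inr \o f)) theta.

(* [S_a(C)]: complete types over [C] in the variables [I], consistent with the
   elementary diagram of [C] and containing the type of the tuple [a] over the
   empty set. *)
Definition types (L : language) (C : structure L) (I : Type) (a : I -> C) :
    set (set (formula L (I + C))) :=
  [set p |
    [/\ forall (n : nat) (theta : 'I_n -> formula L (I + C)),
          (forall i, p (theta i)) ->
          exists c : I -> C, forall i, sat C (theta i) (env_sum c id),
        forall theta, p theta \/ p (FNot theta)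
      & forall phi : formula L I, sat C phi a -> p (rename inl phi)]].

Definition act (L : language) (C : structure L) (I : Type) (g : aut C)
    (p : set (formula L (I + C))) : set (formula L (I + C)) :=
  [set theta | p (reparam (aut_inv g) theta)].

Definition orbit_type (L : language) (C : structure L) (I : Type)
    (p : set (formula L (I + C))) : set (set (formula L (I + C))) :=
  [set act g p | g in [set: aut C]].

Definition invariant (L : language) (C : structure L) (B : set C) (I : Type)
    (p : set (formula L (I + C))) : Prop :=
  forall g : aut C, (forall b, B b -> g b = b) -> act g p = p.

Definition inv_types (L : language) (C : structure L) (I : Type) (a : I -> C)
    (B : set C) : set (set (formula L (I + C))) :=
  [set p | types a p /\ invariant B p].

Section TwoMonsters.
Variables (L : language) (C C' : structure L) (j : C -> C').
Variables (I : Type) (a : I -> C) (B : set C).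

Definition restrict_type (p' : set (formula L (I + C'))) : set (formula L (I + C)) :=
  [set theta | p' (reparam j theta)].

(* [p|_C'] *)
Definition inv_extension (p : set (formula L (I + C))) : set (formula L (I + C')) :=
  xget set0 [set p' | inv_types (j \o a) (j @` B) p' /\ restrict_type p' = p].

(* [tp(sigma(a)/C)] *)
Definition tp (sigma : aut C') : set (formula L (I + C)) :=
  [set theta | sat C' theta (env_sum (sigma \o j \o a) j)].

(* Some [sigma] with [q = tp(sigma(a)/C)]. When [C'] is homogeneous over [C] and
   [a] enumerates a model containing [B], the choice of [sigma] matters neither
   in [star] nor in [rho (Autf_KP _ C')]. *)
Definition realizer (q : set (formula L (I + C))) : aut C' :=
  xget (aut_one C') [set sigma | q = tp sigma].

Definition star (p q : set (formula L (I + C))) : set (formula L (I + C)) :=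
  restrict_type (act (realizer q) (inv_extension p)).

(* [Gamma] stands for [Autf_KP(C')], so that the values are elements of
   [Gal_KP(T)]. *)
Definition rho (Gamma : set (aut C')) (p : set (formula L (I + C))) :
    set (aut C') :=
  left_coset (aut_inv (realizer p)) Gamma.

End TwoMonsters.

(** ** Kim-Pillay strong automorphisms *)

Definition type_definable_rel (L : language) (C : structure L) (X : Type)
    (Phi : set (formula L (X + X))) (a b : X -> C) : Prop :=
  forall phi, Phi phi -> sat C phi (env_sum a b).

Definition bounded_rel (K X : Type) (E : X -> X -> Prop) : Prop :=
  card_lt [set [set y | E x y] | x in [set: X]] [set: K].

(* Automorphisms fixing all classes of all bounded type-definable over the empty
   set equivalence relations on tuples of small length. *)
Definition Autf_KP (L : language) (K : Type) (C : structure L) : set (aut C) :=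
  [set g : aut C | forall X : Type, small K X ->
     forall Phi : set (formula L (X + X)),
       RelationClasses.Equivalence (@type_definable_rel L C X Phi) ->
       bounded_rel K (@type_definable_rel L C X Phi) ->
       forall a : X -> C, type_definable_rel Phi a (g \o a)].

Arguments Autf_KP {L} K C _.

(** ** f-generic types *)

Definition fGen (L : language) (K : Type) (C : structure L) (I : Type)
    (a : I -> C) (B : set C) : set (set (formula L (I + C))) :=
  [set p | inv_types a B p /\ card_lt (orbit_type p) [set: K]].

(** ** Amenability *)

Definition clopen (L : language) (C : structure L) (I : Type) (a : I -> C)
    (theta : formula L (I + C)) : set (set (formula L (I + C))) :=
  [set p | types a p /\ p theta].

(* A finitely additive probability measure on the clopen subsets of [S_a(C)];
   the values of [mu] on other sets are irrelevant. *)
Record Keisler_measure (R : realType) (L : language) (C : structure L) (I : Type)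
    (a : I -> C) (mu : set (set (formula L (I + C))) -> R) : Prop := {
  Keisler_ge0 : forall theta, (0 <= mu (clopen a theta))%R;
  Keisler_total : mu (types a) = 1%R;
  Keisler_additive : forall theta psi,
    clopen a theta `&` clopen a psi = set0 ->
    mu (clopen a theta `|` clopen a psi) =
      (mu (clopen a theta) + mu (clopen a psi))%R }.

Definition amenable (R : realType) (L : language) (C : structure L) (I : Type)
    (a : I -> C) : Prop :=
  exists mu : set (set (formula L (I + C))) -> R,
    Keisler_measure a mu /\
    forall (g : aut C) theta,
      mu [set act g p | p in clopen a theta] = mu (clopen a theta).

(** ** Ideals and Ellis groups

The semigroup is [(S, op)], where [S] is a subset of [X] and only the values of
[op] on [S] matter. *)

Section Semigroup.
Variables (X : Type) (S : set X) (op : X -> X -> X).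

Definition left_ideal (J : set X) : Prop :=
  [/\ J !=set0, J `<=` S & forall x y, S x -> J y -> J (op x y)].

Definition right_ideal (J : set X) : Prop :=
  [/\ J !=set0, J `<=` S & forall x y, J x -> S y -> J (op x y)].

Definition two_sided_ideal (J : set X) : Prop := left_ideal J /\ right_ideal J.

Definition minimal_left_ideal (J : set X) : Prop :=
  left_ideal J /\ forall J', left_ideal J' -> J' `<=` J -> J' = J.

Definition minimal_right_ideal (J : set X) : Prop :=
  right_ideal J /\ forall J', right_ideal J' -> J' `<=` J -> J' = J.

Definition Ellis_group (E : set X) : Prop :=
  exists (J : set X) (u : X),
    [/\ minimal_left_ideal J, J u, op u u = u & E = [set op u x | x in J]].

End Semigroup.

(* Main.v *)
Require Import Defs.
From mathcomp Require Import all_boot ssralg ssrnum order archimedean zify.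
From mathcomp Require Import boolp classical_sets functions cardinality reals filter.

(** An invariant type has bounded orbit exactly when all its conjugates under
[Aut(C)] are [M]-invariant: a coheir realized over a small set of
representatives cannot be distinguished from its model by the orbit. Hence, for
[p] f-generic and [q] in [S], the product [p * q] is [g p] for every [g] such
that [g n] realizes [q|_M], and coheirs show that every [g] arises. As moreover
[g (p * q) = p * (g q)], each f-generic orbit contains an idempotent [u], with
[u * g u = g u], and (1)-(4) follow once an f-generic type exists.

For existence, if [b] and [b'] have the same type over [M] then
[phi(x, b) /\ ~ phi(x, b')] has measure zero: otherwise invariance of the
measure yields a Morley sequence along which [phi] alternates infinitely often,
against NIP. So a type all of whose formulas have positive measure is invariant
over every copy of [M], and it is extended from [m] to [n] along a coheir of
[tp(n/M)].

For (5), let [H] be the group of automorphisms fixing the orbit of [u]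
pointwise. If [c] realizes [u] over [n] and [h n], then [n] and [h n] have the
same type over [c], so [H] is the product of two pointwise stabilizers of
conjugates of [n]. Hence being [H]-conjugate is type-definable; it is a bounded
equivalence relation, which KP-strong automorphisms preserve, and it determines
the product with [u]. *)

Set Implicit Arguments.
Unset Strict Implicit.
Unset Printing Implicit Defensive.

Local Open Scope classical_set_scope.

(** * Small cardinals *)

Section Cardinals.
Local Open Scope card_scope.

(** The product is defined through [C'], but a formula has finitely many parameters [b]: if
    [q = tp(tau(n)/C)], then [phi(x, b)] lies in [p * q] iff [phi(x, b1)] lies in [p], for any [b1]
    in [C] with the type of [tau^-1(b)] over [n]. So the algebra takes place in [C]. Only [q|_M]
    matters in [p * q] because of a rigidity: when [p] and [g p] are both [M]-invariant, [g p]
    depends only on the type of [g M] over [M]. In the measure argument [b] and [b'] need not lie on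
    a common Morley sequence. Each is compared with a third tuple that follows both of them in the
    coheir sense. The measure lives on types in the variables of [m], the semigroup on types in the
    variables of [n]; hence the extension. In (5) the group [H] acts on [C], while strong
    automorphisms act on [C']. Type-definability carries the relation across, and it holds for a
    product of two stabilizers because saturation finds the intermediate tuple. *)

Definition embeds (X Y : Type) : Prop := exists f : X -> Y, injective f.

Lemma card_leE (A B : Type) (X : set A) (Y : set B) :
  (X #<= Y) <-> embeds X Y.
Proof.
split=> [/card_leP[f]|[f f_inj]].
  by exists f => x y fxy; apply: (@inj _ _ _ f) => //; apply/mem_set.
apply/card_leP/injfunPex; exists f => //.
by move=> x y _ _ /f_inj.
Qed.

Lemma embeds_setT (X : Type) : embeds [set: X] X /\ embeds X [set: X].
Proof.
split; first by exists set_val; exact: val_inj.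
exists (fun x => SigSub (mem_set (I : [set: X] x))).
by move=> x y [].
Qed.

Lemma embeds_trans (X Y Z : Type) : embeds X Y -> embeds Y Z -> embeds X Z.
Proof. by move=> [f fi] [g gi]; exists (g \o f); exact: inj_comp. Qed.

Lemma embeds_surj (X Y : Type) (f : X -> Y) :
  (forall y, exists x, f x = y) -> embeds Y X.
Proof.
by move=> /choice[g gK]; exists g => x y gxy; rewrite -[x]gK gxy gK.
Qed.

(** Zorn's lemma on graphs of partial injections: a maximal graph is total on [X] or onto [Y], since
    otherwise a pair of missed points could be added. *)
Lemma embeds_total (X Y : Type) : embeds X Y \/ embeds Y X.
Proof.
pose P : set (set (X * Y)) := [set G | forall x y x' y', G (x, y) -> G (x', y') ->
  (x = x' <-> y = y')].
have [F FP Ftot|G [GP Gmax]] := @Zorn_bigcup (X * Y) P.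
  move=> x y x' y' [G FG Gxy] [G' FG' Gxy'].
  have [/(_ _ Gxy)|/(_ _ Gxy')] := Ftot _ _ FG FG'.
    by move=> ?; apply: (FP _ FG').
  by move=> ?; apply: (FP _ FG).
have [Xtot|/existsNP[x0 x0N]] := pselect (forall x, exists y, G (x, y)).
  left; have [f fG] := choice Xtot; exists f => x x' fxx'.
  exact/(GP _ _ _ _ (fG x) (fG x')).
right.
have [Ytot|/existsNP[y0 y0N]] := pselect (forall y, exists x, G (x, y)).
  have [f fG] := choice Ytot; exists f => x x' fxx'.
  exact/(GP _ _ _ _ (fG x) (fG x')).
exfalso; apply: (Gmax (G `|` [set (x0, y0)])).
  split; first by move=> u Gu; left.
  by move=> /(_ (x0, y0)) sub; apply: x0N; exists y0; apply: sub; right.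
move=> x y x' y' [Gxy|[-> ->]] [Gxy'|[-> ->]] //.
- exact: GP.
- by split=> e; [exfalso; apply: x0N; exists y; rewrite -e|exfalso; apply: y0N;
  exists x; rewrite -e].
- by split=> e; [exfalso; apply: x0N; exists y'; rewrite e|exfalso; apply: y0N;
  exists x'; rewrite e].
Qed.

Lemma card_lt_smallE (K A : Type) (X : set A) :
  card_lt X [set: K] <-> ~ embeds K X.
Proof.
have [toK fromK] := embeds_setT K.
rewrite /card_lt !card_leE; split=> [[_ nle] KX|nKX].
  exact/nle/(embeds_trans toK).
split; last by move=> h; apply/nKX/(embeds_trans fromK).
by have [//|/(embeds_trans fromK)] := embeds_total X [set: K].
Qed.

Lemma smallE (K X : Type) : small K X <-> ~ embeds K X.
Proof.
have [toX fromX] := embeds_setT X.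
rewrite /small card_lt_smallE; split=> nKX KX; apply: nKX.
  exact: embeds_trans fromX.
exact: embeds_trans toX.
Qed.

Lemma card_lt_small (K A : Type) (X : set A) :
  card_lt X [set: K] <-> small K X.
Proof. by rewrite card_lt_smallE smallE. Qed.

Lemma small_embeds (K X Y : Type) : embeds X Y -> small K Y -> small K X.
Proof. by rewrite !smallE => XY nKY KX; apply: nKY; exact: embeds_trans XY. Qed.

Lemma small_inj (K X Y : Type) (f : X -> Y) :
  injective f -> small K Y -> small K X.
Proof. by move=> fi; apply: small_embeds; exists f. Qed.

Lemma small_surj (K X Y : Type) (f : X -> Y) :
  (forall y, exists x, f x = y) -> small K X -> small K Y.
Proof. by move=> /embeds_surj; exact: small_embeds. Qed.

Lemma small_range (K X Y : Type) (f : X -> Y) : small K X -> card_lt (range f) [set: K].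
Proof.
move=> sX; apply/card_lt_small.
apply: (@small_surj _ _ _ (fun x => SigSub (mem_set (imageT f x)) : range f)) sX.
by case=> y /[dup] /set_mem[x _ <-] yf; exists x; exact: val_inj.
Qed.

(** * Closure of small types under set constructions *)

Section StrongLimit.
Variables (K : Type) (K_lim : strong_limit K).

Lemma small_set (X : Type) : small K X -> small K (set X).
Proof.
move=> sX; have [XK|KX] := embeds_total X K; last by move/smallE: sX.
have [f f_inj] := XK.
have sP : small K [set Y | Y `<=` range f].
  by apply: (proj1 (card_lt_small _ _)); apply: K_lim; exact: small_range.
have imP (A : set X) : (f @` A) `<=` range f by move=> _ [x _ <-]; exists x.
pose F (A : set X) : [set Y | Y `<=` range f] :=
  SigSub (mem_set (imP A : [set Y | Y `<=` range f] (f @` A))).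
apply: small_inj sP; apply: (_ : injective F) => A B [] /seteqP[AB BA].
apply/seteqP; split=> x Ax.
  by have [y By /f_inj <-] := AB (f x) (imageP f Ax).
by have [y By /f_inj <-] := BA (f x) (imageP f Ax).
Qed.

(** Closure under power sets replaces cardinal arithmetic: both summands are coded in the double
    power set of the larger one, and the extra member [set0] keeps the two kinds of codes apart. *)
Lemma small_sum (X Y : Type) : small K X -> small K Y -> small K (X + Y).
Proof.
wlog XY : X Y / embeds X Y => [wl sX sY|].
  have [XY|YX] := embeds_total X Y; first exact: wl.
  apply: (@small_inj _ _ (Y + X)%type (fun z => match z with inl x => inr x | inr y
    => inl y end)).
    by move=> [x|x] [y|y] // [->].
  exact: wl.
move=> _ sY; have [f f_inj] := XY.
apply: small_inj (small_set (small_set sY)).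
pose F (z : X + Y) : set (set Y) :=
  match z with inl x => [set [set f x]] | inr y => [set [set y]; set0] end.
have s1 (y : Y) : [set y] <> set0 by move/seteqP => [/(_ y erefl)].
have s2 (y z : Y) : [set y] = [set z] -> y = z.
  by move/seteqP => [/(_ y erefl)].
apply: (_ : injective F) => -[x|x] [y|y] /= /seteqP[h1 h2].
- by congr inl; apply: f_inj; apply: s2; exact: (h1 [set f x] erefl).
- by have := h2 set0 (or_intror erefl) => /= /esym/s1.
- by have := h1 set0 (or_intror erefl) => /= /esym/s1.
- congr inr; apply: s2; have [//|/= /s1//] := h1 [set x] (or_introl erefl).
Qed.

Lemma small_prod (X Y : Type) : small K X -> small K Y -> small K (X * Y).
Proof.
move=> sX sY; apply: small_inj (small_set (small_sum sX sY)).
pose F (z : X * Y) : set (X + Y) := [set inl z.1; inr z.2].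
apply: (_ : injective F) => -[x y] [x' y'] /seteqP[h _].
have /= [[->]|//] := h (inl x) (or_introl erefl).
by have /= [//|[->]] := h (inr y) (or_intror erefl).
Qed.

Lemma small_fun (X Y : Type) : small K X -> small K Y -> small K (X -> Y).
Proof.
move=> sX sY; apply: small_inj (small_set (small_prod sX sY)).
pose F (f : X -> Y) : set (X * Y) := [set z | f z.1 = z.2].
apply: (_ : injective F) => f g /seteqP[h _]; apply/funext => x.
by have /= := h (x, f x) erefl.
Qed.

End StrongLimit.

End Cardinals.

(** * Syntax and elementary equivalence of tuples *)

Section Syntax.
Variable L : language.

Lemma eval_rename (A : structure L) (V W : Type) (f : V -> W) (t : term L V) v :
  eval (rename_term f t) v = eval t (v \o f) :> A.
Proof. by elim: t => //= g a IH; congr fint; apply/funext. Qed.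

Lemma env_cons_omap (A V W : Type) (a : A) (f : V -> W) v :
  env_cons a v \o omap f = env_cons a (v \o f).
Proof. by apply/funext => -[]. Qed.

Lemma sat_rename (A : structure L) (V W : Type) (f : V -> W) (phi : formula L V) v :
  sat A (rename f phi) v = sat A phi (v \o f).
Proof.
elim: phi W f v => //= {V} V.
- by move=> s t W f v; rewrite !eval_rename.
- by move=> r a W f v; congr (rint A r _); apply/funext => i; rewrite eval_rename.
- by move=> phi IH1 psi IH2 W f v; rewrite IH1 IH2.
- move=> phi IH W f v; apply/propext.
  by split=> h a; have := h a; rewrite IH env_cons_omap.
Qed.

Lemma rename_term_comp (U V W : Type) (f : U -> V) (g : V -> W) (t : term L U) :
  rename_term g (rename_term f t) = rename_term (g \o f) t.
Proof. by elim: t => //= h a IH; congr TApp; apply/funext. Qed.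

Lemma rename_comp (U V W : Type) (f : U -> V) (g : V -> W) (phi : formula L U) :
  rename g (rename f phi) = rename (g \o f) phi.
Proof.
elim: phi V W f g => //= {U} U.
- by move=> s t V W f g; rewrite !rename_term_comp.
- move=> r a V W f g; congr FRel; apply/funext => i; exact: rename_term_comp.
- by move=> phi IH1 psi IH2 V W f g; rewrite IH1 IH2.
- move=> phi IH V W f g; rewrite IH; congr (FAll (rename _ phi)).
  by apply/funext => -[].
Qed.

Lemma rename_term_id (V : Type) (t : term L V) : rename_term id t = t.
Proof. by elim: t => //= h a IH; congr TApp; apply/funext. Qed.

Lemma rename_id (V : Type) (phi : formula L V) : rename id phi = phi.
Proof.
elim: phi => //= {}V.
- by move=> s t; rewrite !rename_term_id.
- by move=> r a; congr FRel; apply/funext => i; exact: rename_term_id.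
- by move=> phi -> psi ->.
- move=> phi {2}<-; congr (FAll (rename _ phi)).
  by apply/funext => -[].
Qed.

Lemma finType_term_split (V : Type) (t : term L V) :
  exists (W : finType) (f : W -> V) (s : term L W), t = rename_term f s.
Proof.
elim: t => [v|g a IH]; first by exists unit, (fun=> v), (TVar L tt).
have /choice[F FP] i : exists F : {W : finType & ((W ->
  V) * term L W)%type}, a i = rename_term (tagged F).1 (tagged F).2.
  by have [W [f [s ->]]] := IH i; exists (existT _ W (f, s)).
pose W i := tag (F i).
exists {i : 'I_(farity g) & W i}, (fun u => (tagged (F (tag u))).1 (tagged u)).
exists (TApp (fun i => rename_term (fun w => Tagged W w) (tagged (F i)).2)).
by rewrite /=; congr TApp; apply/funext => i; rewrite FP rename_term_comp.
Qed.

Lemma finType_formula_split (V : Type) (phi : formula L V) :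
  exists (W : finType) (f : W -> V) (psi : formula L W), phi = rename f psi.
Proof.
elim: phi => {}V.
- by exists void, (of_void V), FFalse.
- move=> s t.
  have [W1 [f1 [s' ->]]] := finType_term_split s.
  have [W2 [f2 [t' ->]]] := finType_term_split t.
  exists (W1 + W2)%type, (fun w => match w with inl u => f1 u | inr u => f2 u end).
  exists (FEq (rename_term inl s') (rename_term inr t')).
  by rewrite /= !rename_term_comp.
- move=> r a.
  have /choice[F FP] i : exists F : {W : finType & ((W ->
    V) * term L W)%type}, a i = rename_term (tagged F).1 (tagged F).2.
  by have [W [f [s ->]]] := finType_term_split (a i); exists (existT _ W (f, s)).
  pose W i := tag (F i).
  exists {i : 'I_(rarity r) & W i}, (fun u => (tagged (F (tag u))).1 (tagged u)).
  exists (FRel (fun i => rename_term (fun w => Tagged W w) (tagged (F i)).2)).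
  by rewrite /=; congr FRel; apply/funext => i; rewrite FP rename_term_comp.
- move=> phi [W1 [f1 [s' ->]]] psi [W2 [f2 [t' ->]]].
  exists (W1 + W2)%type, (fun w => match w with inl u => f1 u | inr u => f2 u end).
  exists (FImp (rename inl s') (rename inr t')).
  by rewrite /= !rename_comp.
- move=> phi [W [f [psi ->]]].
  (* Indices that [f] sends to the bound variable are merged into [None]; they no longer occur free,
     so [v0] is an arbitrary value for them. When [V] is empty every index is of that kind. *)
  have [[v0]|V0] := pselect (inhabited V).
    exists W, (fun w => odflt v0 (f w)).
    exists (FAll (rename (fun w => if f w is Some _ then Some w else None) psi)).
    rewrite /= rename_comp; congr (FAll (rename _ psi)).
    by apply/funext => w /=; case E: (f w) => [v|] //=; rewrite E.
  exists void, (of_void V), (FAll (rename (fun=> None) psi)).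
  rewrite /= rename_comp; congr (FAll (rename _ psi)).
  by apply/funext => w /=; case: (f w) => // v; case: V0.
Qed.

Lemma formula_split (V : Type) (phi : formula L V) :
  exists k (f : 'I_k -> V) (psi : formula L 'I_k), phi = rename f psi.
Proof.
have [W [f [psi ->]]] := finType_formula_split phi.
exists #|W|, (f \o enum_val), (rename enum_rank psi).
by rewrite rename_comp; congr rename; apply/funext => w /=; rewrite enum_rankK.
Qed.

Lemma formula_params (V A : Type) (a0 : A) (phi : formula L (V + A)) :
  exists k (b : 'I_k -> A) (psi : formula L (V + 'I_k)), phi = reparam b psi.
Proof.
have [k [f [psi ->]]] := formula_split phi.
exists k, (fun l => if f l is inr a then a else a0).
exists (rename (fun l => if f l is inl v then inl v else inr l) psi).
rewrite /reparam rename_comp; congr rename; apply/funext => l /=.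
by case E: (f l) => [v|a] //=; rewrite E.
Qed.

Lemma formula_params_family (V A : Type) (a0 : A) n (phi : 'I_n -> formula L (V + A)) :
  exists k (b : 'I_k -> A) (psi : 'I_n -> formula L (V + 'I_k)),
    forall i, phi i = reparam b (psi i).
Proof.
have /choice[F FP] i : exists F : {k : nat & (('I_k ->
  A) * formula L (V + 'I_k))%type}, phi i = reparam (tagged F).1 (tagged F).2.
  by have [k [b [psi ->]]] := formula_params a0 (phi i); exists (existT _ k (b, psi)).
pose k i := tag (F i); pose b i := (tagged (F i)).1; pose psi i := (tagged (F i)).2.
pose W := {i : 'I_n & 'I_(k i)}.
exists #|{: W}|, (fun l => let w := enum_val l : W in b (tag w) (tagged w)).
exists (fun i => reparam (fun l => enum_rank (Tagged (fun i => 'I_(k i)) l : W)) (psi i)).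
move=> i; rewrite FP /reparam rename_comp; congr rename.
by apply/funext => -[//|l] /=; rewrite enum_rankK.
Qed.

Definition FAnd (V : Type) (phi psi : formula L V) := FNot (FImp phi (FNot psi)).

Lemma sat_FNot (A : structure L) (V : Type) (phi : formula L V) v :
  sat A (FNot phi) v = ~ sat A phi v.
Proof. by []. Qed.

Lemma sat_FAnd (A : structure L) (V : Type) (phi psi : formula L V) v :
  sat A (FAnd phi psi) v = (sat A phi v /\ sat A psi v).
Proof.
apply/propext => /=; split=> [h|[h1 h2] h]; last exact: (h h1 h2).
by split; apply: contrapT => h'; apply: h => // ? ?.
Qed.

Fixpoint FConj (V : Type) n : ('I_n -> formula L V) -> formula L V :=
  match n with
  | 0 => fun=> FNot FFalse
  | k.+1 => fun phi => FAnd (phi ord0) (FConj (fun i => phi (lift ord0 i)))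
  end.

Lemma sat_FConj (A : structure L) (V : Type) n (phi : 'I_n -> formula L V) v :
  sat A (FConj phi) v = forall i, sat A (phi i) v.
Proof.
apply/propext; elim: n phi => [|n IH] phi; first by split=> // _ [].
rewrite [FConj _]/= sat_FAnd IH; split=> [[h0 h] i|h]; last by split.
by case: (unliftP ord0 i) => [j|] ->.
Qed.

Definition FEx (V : Type) (phi : formula L (option V)) := FNot (FAll (FNot phi)).

Lemma sat_FEx (A : structure L) (V : Type) (phi : formula L (option V)) v :
  sat A (FEx phi) v = exists a, sat A phi (env_cons a v).
Proof.
apply/propext => /=; split=> [h|[a h] h']; last exact: (h' a).
by apply: contrapT => /forallNP h'; apply: h => a; exact: h'.
Qed.

Lemma ex_quant_ord k (V : Type) (phi : formula L ('I_k + V)) :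
  exists psi : formula L V, forall (A : structure L) v,
    sat A psi v <-> exists c : 'I_k -> A, sat A phi (env_sum c v).
Proof.
elim: k V phi => [|k IH] V phi.
  have noI0 (i : 'I_0) : False by case: i.
  pose s0 (x : 'I_0 + V) : V :=
    match x with inl i => False_rect V (noI0 i) | inr v => v end.
  exists (rename s0 phi) => A v; rewrite sat_rename.
  have E (c : 'I_0 -> A) : v \o s0 = env_sum c v.
    by apply/funext => -[i|] //; case: (noI0 i).
  split=> [h|[c]]; last by rewrite -E.
  by exists (fun i => False_rect A (noI0 i)); rewrite -E.
pose s (x : 'I_k.+1 + V) : 'I_k + option V :=
  match x with inl i => if unlift ord0 i is Some l then inl l else inr None
             | inr v => inr (Some v) end.
have [psi psiP] := IH _ (rename s phi).
exists (FEx psi) => A v; rewrite sat_FEx; split=> [[a /psiP[c]]|[c h]].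
  rewrite sat_rename => h; exists (fun i => if unlift ord0 i is Some l then c l else a).
  by congr (sat A phi _): h; apply/funext => -[i|//] /=; case: unlift.
exists (c ord0); apply/psiP; exists (c \o lift ord0); rewrite sat_rename.
congr (sat A phi _): h; apply/funext => -[i|//] /=.
by case: unliftP => [j|] ->.
Qed.

Lemma ex_quant (I V : Type) (phi : formula L (I + V)) :
  exists psi : formula L V, forall (A : structure L) v,
    sat A psi v <-> exists c : I -> A, sat A phi (env_sum c v).
Proof.
have [k [f [phi0 ->]]] := formula_split phi.
(* [f] need not be injective: [R] selects one index per variable, so that repeated occurrences of a
   quantified variable receive the same value. *)
have [R RP] : exists R : I + V ->
  option 'I_k, forall l, exists2 l', R (f l) = Some l' & f l' = f l.
  have /choice[R RP] z : exists r, (exists l, f l = z) ->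
    exists2 l', r = Some l' & f l' = z.
    have [[l fl]|n] := pselect (exists l, f l = z); first by exists (Some l) => _;
      exists l.
    by exists None => /n.
  by exists R => l; apply: RP; exists l.
have [psi psiP] := ex_quant_ord (rename (fun l => match f l with
   inl i => inl (odflt l (R (f l))) | inr v => inr v end) phi0).
exists psi => A v; split=> [/psiP[c]|[c]]; rewrite !sat_rename => h.
  have [a0] := carrier_inhabited A.
  exists (fun i => if R (inl i) is Some l then c l else a0); rewrite sat_rename.
  congr (sat A phi0 _): h; apply/funext => l /=.
  have [l' + fl] := RP l; case: (f l) => [i|//] Rl.
  by rewrite /= Rl.
have [a0] := carrier_inhabited A.
apply/psiP; exists (fun l => if f l is inl i then c i else a0); rewrite sat_rename.
congr (sat A phi0 _): h; apply/funext => l /=.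
have [l' + fl] := RP l; case: (f l) fl => [i|//] fl /= -> /=.
by rewrite fl.
Qed.

Lemma env_sum_comp (X Y A B : Type) (g : A -> B) (v : X -> A) (w : Y -> A) :
  g \o env_sum v w = env_sum (g \o v) (g \o w).
Proof. by apply/funext => -[]. Qed.

Lemma env_sum_reparam (X Y Z A : Type) (f : Z -> Y) (v : X -> A) (w : Y -> A) :
  env_sum v w \o env_sum inl (inr \o f) = env_sum v (w \o f).
Proof. by apply/funext => -[]. Qed.

Lemma sat_reparam (A : structure L) (X Y Z : Type) (f : Z -> Y) (v : X ->
  A) (w : Y -> A) phi :
  sat A (reparam f phi) (env_sum v w) = sat A phi (env_sum v (w \o f)).
Proof. by rewrite /reparam sat_rename env_sum_reparam. Qed.

Lemma reparam_comp (X A B D : Type) (f : A -> B) (g : B -> D) (phi : formula L (X + A)) :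
  reparam g (reparam f phi) = reparam (g \o f) phi.
Proof. by rewrite /reparam rename_comp; congr rename; apply/funext => -[]. Qed.

Lemma reparam_id (X A : Type) (phi : formula L (X + A)) : reparam id phi = phi.
Proof. by rewrite -[RHS]rename_id; congr rename; apply/funext => -[]. Qed.

Lemma reparam_FNot (X A B : Type) (f : A -> B) (phi : formula L (X + A)) :
  reparam f (FNot phi) = FNot (reparam f phi).
Proof. by []. Qed.

(** Equality of types over the empty set, possibly across two structures. Applied to [env_sum i b]
    and [env_sum i b'] it is equality of types over the model enumerated by [i]. *)
Definition elequiv (A B : structure L) (V : Type) (v : V -> A) (w : V -> B) : Prop :=
  forall phi : formula L V, sat A phi v <-> sat B phi w.

Lemma elequiv_refl (A : structure L) (V : Type) (v : V -> A) : elequiv v v.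
Proof. by []. Qed.

Lemma elequiv_sym (A B : structure L) (V : Type) (v : V -> A) (w : V -> B) :
  elequiv v w -> elequiv w v.
Proof. by move=> h phi; rewrite h. Qed.

Lemma elequiv_trans (A B D : structure L) (V : Type) (v : V -> A) (w : V ->
  B) (u : V -> D) :
  elequiv v w -> elequiv w u -> elequiv v u.
Proof. by move=> h h' phi; rewrite h. Qed.

Lemma elequiv_comp (A B : structure L) (V W : Type) (f : W -> V) (v : V ->
  A) (w : V -> B) :
  elequiv v w -> elequiv (v \o f) (w \o f).
Proof. by move=> h phi; have := h (rename f phi); rewrite !sat_rename. Qed.

Lemma elequiv_imp (A B : structure L) (V : Type) (v : V -> A) (w : V -> B) :
  (forall phi, sat A phi v -> sat B phi w) -> elequiv v w.
Proof.
move=> h phi; split; first exact: h.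
by move=> hw; apply: contrapT => /(h (FNot phi)); apply.
Qed.

Lemma elementary_on_elequiv (A B : structure L) (D : set A) (f : A ->
  B) (V : Type) (v : V -> A) :
  elementary_on D f -> (forall x, D (v x)) -> elequiv v (f \o v).
Proof.
move=> fD Dv phi; have [k [g [psi ->]]] := formula_split phi.
by rewrite !sat_rename; apply: fD => i; exact: Dv.
Qed.

Lemma elementary_elequiv (A B : structure L) (f : A -> B) (V : Type) (v : V -> A) :
  elementary f -> elequiv v (f \o v).
Proof. by move=> fE; exact: elementary_on_elequiv fE _. Qed.

Lemma elementary_comp (A B D : structure L) (f : A -> B) (g : B -> D) :
  elementary f -> elementary g -> elementary (g \o f).
Proof.
move=> fE gE n phi a _.
exact: (elequiv_trans (elementary_elequiv a fE) (elementary_elequiv (f \o a) gE)).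
Qed.

Lemma elequiv_eq (A B : structure L) (V : Type) (v : V -> A) (w : V -> B) x y :
  elequiv v w -> v x = v y -> w x = w y.
Proof. by move=> h; have := h (FEq (TVar L x) (TVar L y)); rewrite /= => ->. Qed.

Lemma elementary_inj (A B : structure L) (f : A -> B) : elementary f -> injective f.
Proof.
move=> fE x y fxy.
exact: (elequiv_eq (elequiv_sym (elementary_elequiv id fE)) fxy).
Qed.

Lemma elequiv_aut (A : structure L) (g : aut A) (V : Type) (v : V ->
  A) : elequiv v (g \o v).
Proof.
move=> phi; elim: phi v => //= {}V.
- have E t v : eval t (g \o v) = g (eval t v).
    elim: t => //= f a IH; rewrite aut_fint; congr fint; exact/funext.
  by move=> s t v; rewrite !E; split=> [->//|]; exact: (can_inj (aut_funK g)).
- have E t v : eval t (g \o v) = g (eval t v).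
    elim: t => //= f a IH; rewrite aut_fint; congr fint; exact/funext.
  move=> r a v; rewrite -(aut_rint g);
    have -> // : g \o (fun i => eval (a i) v) = fun i => eval (a i) (g \o v).
  by apply/funext => i /=; rewrite E.
- by move=> phi IH1 psi IH2 v; rewrite IH1 IH2.
- have E a v : g \o env_cons a v = env_cons (g a) (g \o v) :> (option V -> A).
    by apply/funext => -[].
  move=> phi IH v; split=> h a; last by rewrite IH E.
  by have /IH := h (aut_invfun g a); rewrite E aut_invfunK.
Qed.

End Syntax.

(** * Complete types over a tuple of parameters *)

Section CompleteTypes.
Variable L : language.

(** Parameters enter only through the formal variables [Z], so a type over [d] can be read over any
    tuple with the same type as [d], also in another structure. *)
Definition fin_sat (A : structure L) (Y Z : Type) (d : Z -> A)
    (p : set (formula L (Y + Z))) : Prop :=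
  forall n (theta : 'I_n -> formula L (Y + Z)), (forall i, p (theta i)) ->
    exists c : Y -> A, forall i, sat A (theta i) (env_sum c d).

Definition ctype (A : structure L) (Y Z : Type) (d : Z -> A)
    (p : set (formula L (Y + Z))) : Prop :=
  fin_sat d p /\ forall theta, p theta \/ p (FNot theta).

Lemma ex_quant_family (I V : Type) n (phi : 'I_n -> formula L (I + V)) :
  exists psi : formula L V, forall (A : structure L) v,
    sat A psi v <-> exists c : I -> A, forall i, sat A (phi i) (env_sum c v).
Proof.
have [psi psiP] := ex_quant (FConj phi).
exists psi => A v; rewrite psiP.
by split=> -[c h]; exists c; move: h; rewrite sat_FConj.
Qed.

Lemma fin_sat_elequiv (A B : structure L) (Y Z : Type) (d : Z -> A) (d' : Z -> B)
    (p : set (formula L (Y + Z))) :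
  elequiv d d' -> fin_sat d p -> fin_sat d' p.
Proof.
move=> dd' pfs n theta ptheta.
have [psi psiP] := ex_quant_family theta.
by apply/psiP/dd'/psiP; exact: pfs.
Qed.

Lemma ctype_elequiv (A B : structure L) (Y Z : Type) (d : Z -> A) (d' : Z -> B)
    (p : set (formula L (Y + Z))) :
  elequiv d d' -> ctype d p -> ctype d' p.
Proof. by move=> dd' [pfs pc]; split=> //; exact: fin_sat_elequiv pfs. Qed.

Section Closure.
Variables (A : structure L) (Y Z : Type) (d : Z -> A) (p : set (formula L (Y + Z))).
Hypothesis pT : ctype d p.

Lemma ctype_closed n (theta : 'I_n -> formula L (Y + Z)) chi :
  (forall i, p (theta i)) ->
  (forall c, (forall i, sat A (theta i) (env_sum c d)) -> sat A chi (env_sum c d)) ->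
  p chi.
Proof.
move=> ptheta imp; have [//|pN] := pT.2 chi.
have [i|c h] := pT.1 n.+1 (fun i => if unlift ord0 i is Some l then theta l else FNot
  chi).
  by case: unlift.
exfalso; have := h ord0; rewrite unlift_none; apply; apply: imp => i.
by have := h (lift ord0 i); rewrite liftK.
Qed.

Lemma ctype_imp theta chi : p theta ->
  (forall c, sat A theta (env_sum c d) -> sat A chi (env_sum c d)) -> p chi.
Proof. by move=> pt h; apply: (@ctype_closed 1 (fun=> theta)) => // c /(_ ord0)/h. Qed.

Lemma ctype_all chi : (forall c, sat A chi (env_sum c d)) -> p chi.
Proof. by move=> h; apply: (@ctype_closed 0 (fun=> chi)) => // -[]. Qed.

Lemma ctype_ex theta : p theta -> exists c, sat A theta (env_sum c d).
Proof.
by move=> pt; have [_|c /(_ ord0) h] := pT.1 1 (fun=> theta); [|exists c].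
Qed.

Lemma ctype_FNot theta : p (FNot theta) <-> ~ p theta.
Proof.
split=> [pN pt|npt]; last by have [] := pT.2 theta.
have [i|c h] := pT.1 2 (fun i => if i == ord0 then theta else FNot theta).
  by case: ifP.
by have /= := h ord_max; apply; exact: (h ord0).
Qed.

Lemma ctype_FAnd theta chi : p (FAnd theta chi) <-> p theta /\ p chi.
Proof.
split=> [h|[h1 h2]].
  by split; apply: (ctype_imp h) => c; rewrite sat_FAnd => -[].
apply: (@ctype_closed 2 (fun i => if i == ord0 then theta else chi)).
  by move=> i; case: ifP.
by move=> c h; rewrite sat_FAnd; split; [exact: (h ord0)|exact: (h ord_max)].
Qed.

Lemma ctype_FConj n (theta : 'I_n -> formula L (Y + Z)) :
  p (FConj theta) <-> forall i, p (theta i).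
Proof.
split=> [h i|h]; first by apply: (ctype_imp h) => c; rewrite sat_FConj.
by apply: (ctype_closed h) => c; rewrite sat_FConj.
Qed.

Lemma ctype_param theta : p (rename inr theta) <-> sat A theta d.
Proof.
split=> [/ctype_ex[c]|h]; first by rewrite sat_rename.
by apply: ctype_all => c; rewrite sat_rename.
Qed.

Lemma ctype_reparam (W : Type) (g : W -> Z) :
  ctype (d \o g) [set theta | p (reparam g theta)].
Proof.
split=> [n theta h|theta]; last exact: pT.2.
have [c cP] := pT.1 _ _ h.
by exists c => i; have := cP i; rewrite sat_reparam.
Qed.

End Closure.

(** The average type of the tuples [F t] along [U]. Completions, coheirs and the type extracted from
    the measure all arise in this way. *)
Lemma ctype_ultra (A : structure L) (Y Z T : Type) (d : Z -> A) (F : T -> Y -> A)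
    (U : set_system T) : UltraFilter U ->
  ctype d [set theta | U [set t | sat A theta (env_sum (F t) d)]].
Proof.
move=> UU; split=> [n theta h|theta]; last exact: in_ultra_setVsetC.
have : U [set t | sat A (FConj theta) (env_sum (F t) d)].
  elim: n theta h => [|n IH] theta h.
    by apply: filterS filterT => t _; rewrite /mkset sat_FConj => -[].
  apply: filterS (filterI (h ord0) (IH (fun i => theta (lift ord0 i)) (fun i => h _))).
  move=> t [h0]; rewrite /mkset !sat_FConj => h1 i.
  by case: (unliftP ord0 i) => [l|] ->.
by move/filter_ex => [t]; rewrite /mkset sat_FConj; exists (F t).
Qed.

Lemma conj_closed_ultra (T V : Type) (S : set (formula L V)) (e : formula L V -> set T) :
    (forall n (theta : 'I_n -> formula L V), (forall i, S (theta i)) ->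
       exists t, forall i, e (theta i) t) ->
  exists U : set_system T, UltraFilter U /\ forall theta, S theta -> U (e theta).
Proof.
move=> fip.
pose F : set_system T := [set P | exists n (theta : 'I_n -> formula L V),
  (forall i, S (theta i)) /\ [set t | forall i, e (theta i) t] `<=` P].
have FF : ProperFilter F.
  apply: Build_ProperFilter_ex.
    by move=> P [n [theta [/fip[t h] sub]]]; exists t; exact: sub.
  split.
  - have noI0 (i : 'I_0) : False by case: i.
    by exists 0, (fun i => False_rect _ (noI0 i)); split=> [[]|].
  - move=> P Q [n [th [th1 th2]]] [n' [th' [th1' th2']]].
    exists (n + n')%N, (fun i => match fintype.split i with inl l => th l | inr l =>
      th' l end).
    split=> [i|t h]; first by case: fintype.split.
    split; [apply: th2 => i; have := h (lshift _ i)|apply: th2' => i; have :=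
      h (rshift _ i)].
      by rewrite (unsplitK (inl i)).
    by rewrite (unsplitK (inr i)).
  - by move=> P Q PQ [n [th [th1 th2]]]; exists n, th; split=> // t /th2/PQ.
have [U [UU FU]] := ultraFilterLemma FF; exists U; split=> // theta St.
by apply: FU; exists 1, (fun=> theta); split=> // t /(_ ord0).
Qed.

Lemma fin_sat_extend (A : structure L) (Y Z : Type) (d : Z ->
  A) (p : set (formula L (Y + Z))) :
  fin_sat d p -> exists2 q, ctype d q & p `<=` q.
Proof.
move=> pfs.
have [U [UU UP]] := @conj_closed_ultra (Y ->
  A) _ p (fun theta => [set c | sat A theta (env_sum c d)]) pfs.
exists [set theta | U [set c | sat A theta (env_sum c d)]]; last exact: UP.
exact: (@ctype_ultra _ _ _ _ d id).
Qed.

Lemma ctype_tp (A : structure L) (Y Z : Type) (c : Y -> A) (d : Z -> A) :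
  ctype d [set theta | sat A theta (env_sum c d)].
Proof. by split=> [n theta h|theta]; [exists c|exact: lem]. Qed.

Lemma typesE (C : structure L) (I : Type) (a : I -> C) p :
  types a p <-> ctype id p /\ forall phi : formula L I, sat C phi a -> p (rename inl phi).
Proof. by split=> [[h1 h2 h3]|[[h1 h2] h3]]. Qed.

End CompleteTypes.

(** * Saturation and homogeneity for infinite tuples *)

Section Saturation.
Variable L : language.

Lemma formula_vars (W Z : Type) (phi : formula L (W + Z)) :
  exists k (f : 'I_k -> W) (psi : formula L ('I_k + Z)),
    phi = rename (env_sum (inl \o f) inr) psi.
Proof.
pose sw (X Y : Type) (z : X + Y) :=
  match z with inl x => inr x | inr y => inl y end : Y + X.
have swK (X Y : Type) : @sw X Y \o @sw Y X = id by apply/funext => -[].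
have [[w0]|W0] := pselect (inhabited W).
  have [k [f [psi E]]] := formula_params w0 (rename (@sw W Z) phi).
  exists k, f, (rename (@sw Z 'I_k) psi).
  rewrite -[LHS]rename_id -(swK Z W) -rename_comp E /reparam !rename_comp.
  by congr rename; apply/funext => -[].
have noI0 (i : 'I_0) : False by case: i.
have [k [f [psi ->]]] := formula_split phi.
exists 0, (fun i => False_rect W (noI0 i)).
exists (rename (fun l => match f l with inl w => False_rect _ (W0 (inhabits w)) | inr
  z => inr z end) psi).
rewrite rename_comp; congr rename; apply/funext => l /=.
by case: (f l) => // w; case: (W0 _).
Qed.

(** [saturated] handles one variable. Zorn's lemma on partial assignments whose finite parts satisfy
    the formulas of [p] reaches small tuples: the next coordinate realizes a one-variable type over
    [d] and the values already chosen. *)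
Lemma saturated_realize_ctype (K : Type) (A : structure L) (Y Z : Type) (d : Z -> A)
    (p : set (formula L (Y + Z))) :
  monster K A -> small K Y -> small K Z -> ctype d p ->
  exists c : Y -> A, forall theta, p theta -> sat A theta (env_sum c d).
Proof.
move=> mon sY sZ pT.
pose Good (G : set (Y * A)) := forall k (f : 'I_k -> Y) (v : 'I_k -> A),
  (forall i, G (f i, v i)) -> forall psi : formula L ('I_k + Z),
  p (rename (env_sum (inl \o f) inr) psi) -> sat A psi (env_sum v d).
have [F FG Ftot|G [GG Gmax]] := @Zorn_bigcup _ Good.
  move=> k f v fv psi ppsi.
  (* The chain [F] may be empty, so the empty assignment is treated apart. *)
  have [k0|[X FX Xfv]] : k = 0 \/ exists2 X, F X & forall i, X (f i, v i).
    elim: k f v fv {psi ppsi} => [|k IH] f v fv; first by left.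
    right; have [X0 FX0 h0] := fv ord0.
    have [k0|[X FX h]] := IH (f \o lift ord0) (v \o lift ord0) (fun i => fv _).
      by exists X0 => // i; subst k; rewrite (ord1 i).
    have [s|s] := Ftot _ _ FX FX0.
      by exists X0 => // i; case: (unliftP ord0 i) => [l|] -> //; apply: s; exact: h.
    by exists X => // i; case: (unliftP ord0 i) => [l|] ->; [exact: h|exact: s].
    have [c] := ctype_ex pT ppsi.
    rewrite sat_rename env_sum_comp.
    by congr (sat A psi (env_sum _ _)); apply/funext => i; subst k; case: i.
  exact: (FG _ FX k f v Xfv psi ppsi).
pose W := {z | G z}.
pose yW (w : W) := (sval w).1; pose vW (w : W) := (sval w).2.
have GW (psi : formula L (W + Z)) :
    p (rename (env_sum (inl \o yW) inr) psi) -> sat A psi (env_sum vW d).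
  have [k [f [psi0 ->]]] := formula_vars psi.
  rewrite sat_rename env_sum_comp rename_comp env_sum_comp => h.
  apply: (GG _ (yW \o f) (vW \o f) _ psi0 h) => i.
  by rewrite /yW /vW /=; case: (f i) => -[].
(* [Good] does not ask [G] to be a function; this follows because [p] contains the equality of each
   variable with itself. *)
have yW_inj : injective yW.
  move=> [[y v] h] [[y' v'] h']; rewrite /yW /= => E; subst y'.
  have E' : v = v'.
    have := GW (FEq (TVar L (inl (exist _ _ h))) (TVar L (inl (exist _ _ h')))).
    by apply; apply: (ctype_all pT).
  by subst v'; congr exist; exact: Prop_irrelevance.
have [tot|/existsNP[y0 y0N]] := pselect (forall y, exists v, G (y, v)).
  have /choice[c cP] := tot; exists c => theta pt.
  have := GW (rename (env_sum (fun y => inl (exist _ _ (cP y) : W)) inr) theta).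
  rewrite rename_comp sat_rename !env_sum_comp; apply.
  by congr p: pt; rewrite -[LHS]rename_id; congr rename; apply/funext => -[].
exfalso.
pose e : W + Z -> A := env_sum vW d.
pose D := range e.
have Dlt : card_lt D [set: K].
  apply: small_range; apply: small_sum => //; first exact: monster_strong_limit mon.
  exact: small_inj yW_inj sY.
pose e' (x : W + Z) : D := SigSub (mem_set (imageT e x)).
have e'E : set_val \o e' = e by [].
pose r1 : unit + (W + Z) -> Y + Z := env_sum (fun=> inl y0) (env_sum (inl \o yW) inr).
pose Sigma : set (formula L (unit + D)) :=
  [set xi | exists2 psi, p (rename r1 psi) & xi = reparam e' psi].
have [n phi|c cP] := monster_saturated mon Dlt (Sigma := Sigma).
  move=> SP; pose h i := cid2 (SP i).
  pose psi i := s2val (h i).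
  have ppsi i : p (rename r1 (psi i)) by exact: s2valP (h i).
  have phiE i : phi i = reparam e' (psi i) by exact: s2valP' (h i).
  have [chi chiP] := ex_quant_family psi.
  have /GW/chiP[c cP] : p (rename (env_sum (inl \o yW) inr) chi).
    apply: (ctype_closed pT ppsi) => c h'; rewrite sat_rename; apply/chiP.
    exists (fun=> c y0) => i; have := h' i; rewrite sat_rename.
    by congr (sat A _ _); apply/funext => -[|[]].
  exists (c tt) => i; rewrite phiE sat_reparam e'E.
  by have := cP i; congr (sat A _ (env_sum _ _)); apply/funext => -[].
apply: (Gmax (G `|` [set (y0, c)])).
  split; first by move=> u Gu; left.
  by move=> /(_ (y0, c)) sub; apply: y0N; exists c; apply: sub; right.
move=> k f v fv psi ppsi.
have /choice[t tP] i : exists t : unit + W, match t with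
    inl _ => (f i, v i) = (y0, c) | inr w => (f i, v i) = (yW w, vW w) end.
  have [h|/= h] := fv i; last by exists (inl tt).
  by exists (inr (exist _ _ h)).
pose s : 'I_k + Z -> unit + (W + Z) := env_sum
  (fun i => match t i with inl u => inl u | inr w => inr (inl w) end) (inr \o inr).
have := cP (reparam e' (rename s psi)); rewrite sat_reparam e'E sat_rename.
have -> : env_sum (fun=> c) e \o s = env_sum v d.
  by apply/funext => -[i|//] /=; have := tP i; case: (t i) => [u|w] [_ ->].
apply; exists (rename s psi) => //; rewrite rename_comp.
congr p: ppsi; congr rename; apply/funext => -[i|//] /=.
by have := tP i; case: (t i) => [u|w] [-> _].
Qed.

Lemma saturated_realize (K : Type) (A : structure L) (Y Z : Type) (d : Z -> A)
    (p : set (formula L (Y + Z))) :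
  monster K A -> small K Y -> small K Z -> fin_sat d p ->
  exists c : Y -> A, forall theta, p theta -> sat A theta (env_sum c d).
Proof.
move=> mon sY sZ /fin_sat_extend[q qT pq].
have [c cP] := saturated_realize_ctype mon sY sZ qT.
by exists c => theta /pq/cP.
Qed.

Lemma homogeneous_aut (K : Type) (A : structure L) (V : Type) (v w : V -> A) :
  monster K A -> small K V -> elequiv v w -> exists g : aut A, g \o v = w.
Proof.
move=> mon sV vw.
have /choice[f fP] a : exists b, forall x, v x = a -> w x = b.
  have [[x vx]|n] := pselect (exists x, v x = a); last first.
    by exists a => x vx; case: n; exists x.
  by exists (w x) => x' vx'; apply: (elequiv_eq vw); rewrite vx'.
have [|g gP] := monster_homogeneous mon (small_range v sV) (f := f).
  move=> n phi a va; pose x i := s2val (cid2 (va i)).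
  have -> : a = v \o x by apply/funext => i; rewrite /= (s2valP' (cid2 (va i))).
  have -> : f \o (v \o x) = w \o x by apply/funext => i /=; rewrite -(fP (v (x i)) (x i)).
  exact: elequiv_comp.
exists g; apply/funext => x /=; rewrite gP; last by exists x.
by rewrite -(fP _ x).
Qed.

(** Brings small configurations of [C'] down to [C] over a fixed tuple, so that statements about
    [C'] can be settled in [C]. *)
Lemma pull_back (K : Type) (A B : structure L) (j : A -> B) (Y Z : Type) (y : Y ->
  B) (a : Z -> A) :
  monster K A -> small K Y -> small K Z -> elementary j ->
  exists y0 : Y -> A, elequiv (env_sum y0 a) (env_sum y (j \o a)).
Proof.
move=> mon sY sZ jE.
have [c cP] := saturated_realize_ctype mon sY sZ
  (ctype_elequiv (elequiv_sym (elementary_elequiv a jE)) (ctype_tp y (j \o a))).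
exists c; apply: elequiv_sym; apply: elequiv_imp => phi h; exact: cP.
Qed.

Lemma realize_ctype (K : Type) (A : structure L) (Y Z : Type) (d : Z -> A)
    (p : set (formula L (Y + Z))) :
  monster K A -> small K Y -> small K Z -> ctype d p ->
  exists c : Y -> A, forall theta, p theta <-> sat A theta (env_sum c d).
Proof.
move=> mon sY sZ pT; have [c cP] := saturated_realize_ctype mon sY sZ pT.
exists c => theta; split; first exact: cP.
by move=> h; apply: contrapT => /(ctype_FNot pT)/cP; apply.
Qed.

End Saturation.

(** * The number of formulas in a small tuple of variables *)

Section SmallFormulas.
Variables (L : language) (K : Type) (C : structure L) (mon : monster K C).

Lemma small_nat : small K nat.
Proof.
apply: small_inj (monster_card mon).
by apply: (_ : injective (fun n => FEq (TVar L n) (TVar L n))) => m n [].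
Qed.

Lemma small_ord k : small K 'I_k.
Proof. exact: small_inj (@ord_inj k) small_nat. Qed.

Lemma small_bool : small K bool.
Proof. by apply: small_inj small_nat; apply: (_ : injective nat_of_bool) => -[] []. Qed.

Lemma small_formula (V : Type) : inhabited V -> small K V -> small K (formula L V).
Proof.
move=> [v0] sV; have K_lim := monster_strong_limit mon.
pose dec (x : formula L nat * (nat -> V)) : formula L V := rename x.2 x.1.
apply: (@small_surj _ _ _ dec); last first.
  by apply: small_prod (monster_card mon) _ => //; apply: small_fun => //;
    exact: small_nat.
move=> theta; have [k [f [psi ->]]] := formula_split theta.
exists (rename val psi, fun n => if insub n is Some i then f i else v0).
rewrite /dec /= rename_comp; congr rename; apply/funext => i /=.
by rewrite valK.
Qed.

End SmallFormulas.

(** * The action of automorphisms on types *)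

Section Actions.
Variables (L : language) (C : structure L) (I : Type).
Implicit Types (g h : aut C) (p : set (formula L (I + C))).

Lemma act_reparam g p (Y : Type) (b : Y -> C) phi :
  act g p (reparam b phi) = p (reparam (aut_invfun g \o b) phi).
Proof. by rewrite /act /mkset reparam_comp. Qed.

Lemma act_mul g h p : act g (act h p) = act (aut_mul g h) p.
Proof.
by apply/funext => theta; rewrite /act /mkset reparam_comp.
Qed.

Lemma act_id g p : (forall x, g x = x) -> act g p = p.
Proof.
move=> gid; apply/funext => theta; rewrite /act /mkset.
suff -> : aut_inv g = id :> (C -> C) by rewrite reparam_id.
by apply/funext => x; rewrite /= -{1}(gid x) aut_funK.
Qed.

Lemma act_one p : act (aut_one C) p = p.
Proof. exact: act_id. Qed.

Lemma actK g p : act (aut_inv g) (act g p) = p.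
Proof. by rewrite act_mul act_id // => x /=; rewrite aut_funK. Qed.

Lemma actVK g p : act g (act (aut_inv g) p) = p.
Proof. by rewrite act_mul act_id // => x /=; rewrite aut_invfunK. Qed.

Lemma act_types (a : I -> C) g p : types a p -> types a (act g p).
Proof.
rewrite !typesE => -[pT pa]; split.
  have E : elequiv (id \o aut_inv g) (id : C -> C).
    by apply: elequiv_sym => phi; exact: (elequiv_aut (aut_inv g) id phi).
  exact: (ctype_elequiv E (ctype_reparam pT _)).
by move=> phi /pa; rewrite /act /mkset /reparam rename_comp.
Qed.

Definition fixes (V : Type) (v : V -> C) p := forall g, g \o v = v -> act g p = p.

Lemma fixes_elequiv (K V Y : Type) (v : V -> C) p (b b' : Y -> C) phi :
  monster K C -> small K V -> small K Y -> fixes v p ->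
  elequiv (env_sum v b) (env_sum v b') ->
  p (reparam b phi) <-> p (reparam b' phi).
Proof.
move=> mon sV sY pv bb'.
have sVY : small K (V + Y) by apply: small_sum => //; exact: monster_strong_limit mon.
have [g gE] := homogeneous_aut mon sVY bb'.
have gv : g \o v = v by apply/funext => x; exact: (congr1 (@^~ (inl x)) gE).
have gb : aut_invfun g \o b' = b.
  by apply/funext => y; have /= <- := congr1 (@^~ (inr y)) gE; rewrite aut_funK.
by rewrite -{2}(pv _ gv) act_reparam gb.
Qed.

Lemma fixes_comp (V W : Type) (v : V -> C) (f : W -> V) p :
  fixes (v \o f) p -> fixes v p.
Proof. by move=> h g gv; apply: h; rewrite compA gv. Qed.

Lemma invariantE (V : Type) (v : V -> C) p : Defs.invariant (range v) p <-> fixes v p.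
Proof.
split=> h g gP; apply: h.
  by move=> _ [x _ <-]; exact: (congr1 (@^~ x) gP).
by apply/funext => x /=; apply: gP; exists x.
Qed.

Lemma fixes_conj (V : Type) (v : V -> C) g p :
  fixes v (act (aut_inv g) p) -> fixes (g \o v) p.
Proof.
move=> h f fgv.
have /h : aut_mul (aut_inv g) (aut_mul f g) \o v = v.
  apply/funext => x /=.
  by have /= -> := congr1 (@^~ x) fgv; rewrite aut_funK.
rewrite -!act_mul actVK => /(congr1 (act g)).
by rewrite !actVK.
Qed.

End Actions.

(** * Finite satisfiability in an elementary submodel *)

Section Coheirs.
Variables (L : language) (C M : structure L) (i : M -> C) (iE : elementary i).

Lemma coheir_ultra (W : Type) (c : W -> C) :
  exists U : set_system (W -> M), UltraFilter U /\
    forall psi : formula L (W + M), sat C psi (env_sum c i) ->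
      U [set w | sat C psi (env_sum (i \o w) i)].
Proof.
pose S : set (formula L (W + M)) := [set psi | sat C psi (env_sum c i)].
have [|U [UU UP]] := @conj_closed_ultra _ (W -> M) _ S
    (fun psi => [set w | sat C psi (env_sum (i \o w) i)]).
  move=> n theta Stheta; have [psi psiP] := ex_quant_family theta.
  have /(elementary_elequiv id iE)/psiP[w wP] : sat C psi i by apply/psiP; exists c.
  exists w => l; have /(elementary_elequiv _ iE) := wP l.
  by rewrite env_sum_comp.
by exists U.
Qed.

End Coheirs.

(** * The star product *)

Lemma elequiv_sub (L : language) (A B : structure L) (V W : Type) (f : W -> V)
    (v : V -> A) (w : V -> B) v' w' :
  elequiv v w -> v' = v \o f -> w' = w \o f -> elequiv v' w'.
Proof. by move=> h -> ->; exact: elequiv_comp. Qed.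

Section Star.
Variables (L : language) (K K' : Type) (C C' : structure L).
Hypotheses (monC : monster K C) (monC' : monster K' C').
Variables (j : C -> C') (jE : elementary j).
Variables (I V : Type) (a : I -> C) (s : V -> I).
Hypotheses (sI : small K I) (sI' : small K' I) (sC : small K' C) (sV :
  small K V) (sV' : small K' V).

(* If [q = tp(sigma a / C)], then [b1] has over [a] the type of [sigma^-1 b]. *)
Definition link (q : set (formula L (I + C))) (Y : Type) (b b1 : Y -> C) : Prop :=
  forall psi : formula L (I + Y), sat C psi (env_sum a b1) <-> q (reparam b psi).

(** Variables and parameters exchange roles: the formulas of [q] over [b] are read as a type over
    [a] in the variables of [b]. It is finitely satisfiable because [q] extends the type of [a]: if
    no [y] solves a formula over [a], then [q] says so of its own realizations. *)
Lemma link_ex q (Y : Type) (b : Y -> C) : types a q -> small K Y ->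
  exists b1, link q b b1.
Proof.
move=> /typesE[qT qa] sY.
pose sw : Y + I -> I + Y := env_sum inr inl.
pose p : set (formula L (Y + I)) := [set psi | q (reparam b (rename sw psi))].
have pT : ctype a p.
  split=> [n theta ptheta|theta]; last exact: qT.2.
  have [chi chiP] := ex_quant_family theta.
  apply/chiP; apply: contrapT => nchi.
  have qn : q (rename inl (FNot chi)) by exact: qa.
  have /(ctype_ex qT) : q (FAnd (rename inl (FNot chi)) (FConj (fun l => reparam b
    (rename sw (theta l))))).
    by apply/(ctype_FAnd qT); split=> //; apply/(ctype_FConj qT).
  move=> [c]; rewrite sat_FAnd sat_FConj sat_rename => -[+ h]; apply.
  apply/chiP; exists b => l; have := h l; rewrite sat_reparam sat_rename.
  by congr (sat C _ _); apply/funext => -[].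
have [b1 b1P] := realize_ctype monC sY sI pT.
exists b1 => psi.
have := b1P (rename (env_sum inr inl) psi); rewrite sat_rename /p /mkset rename_comp.
rewrite (_ : sw \o _ = id); last by apply/funext => -[].
rewrite rename_id => ->.
by rewrite (_ : env_sum b1 a \o _ = env_sum a b1) //; apply/funext => -[].
Qed.

Lemma link_tp (sigma : aut C') (Y : Type) (b b1 : Y -> C) :
  link (tp j a sigma) b b1 <->
  elequiv (env_sum a b1) (env_sum (sigma \o j \o a) (j \o b)).
Proof.
by split=> h phi; have := h phi; rewrite /tp /mkset sat_reparam.
Qed.

Lemma tp_exists q : types a q -> exists sigma : aut C', q = tp j a sigma.
Proof.
move=> /typesE[qT qa].
have qT' : ctype j q by exact: ctype_elequiv (elementary_elequiv id jE) qT.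
have [c cP] := realize_ctype monC' sI' sC qT'.
have jac : elequiv (j \o a) c.
  apply: elequiv_imp => phi /(elementary_elequiv a jE) /qa /cP.
  by rewrite sat_rename.
have [sigma sigmaP] := homogeneous_aut monC' sI' jac.
exists sigma; apply/funext => theta; apply/propext; rewrite cP /tp /mkset.
by rewrite -sigmaP.
Qed.

Lemma realizerP q : types a q -> q = tp j a (realizer j a q).
Proof. by move=> /tp_exists; exact: xgetPex. Qed.

(** * The invariant extension to the larger monster model *)

Section InvariantExtension.
Variable p : set (formula L (I + C)).
Hypothesis pS : inv_types a (range (a \o s)) p.

Let pT : ctype id p. Proof. by have [/typesE[]] := pS. Qed.
Let pfix : fixes (a \o s) p. Proof. by apply/invariantE; case: pS. Qed.

Lemma inv_type_elequiv (Y : Type) (b b1 : Y -> C) phi : small K Y ->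
  elequiv (env_sum a b) (env_sum a b1) -> p (reparam b phi) <-> p (reparam b1 phi).
Proof. by move=> sY; apply: (fixes_elequiv _ monC sI sY); exact: fixes_comp pfix. Qed.

(** Explicit form of [p|_C']: a formula over [b'] is decided by a copy of [b'] in [C] over [a]. The
    presentation of [theta] is quantified because a formula splits in several ways into a finitary
    formula and parameters. *)
Definition heir : set (formula L (I + C')) :=
  [set theta | exists k (phi : formula L (I + 'I_k)) (b' : 'I_k -> C') (b : 'I_k -> C),
    [/\ theta = reparam b' phi, elequiv (env_sum a b) (env_sum (j \o a) b')
      & p (reparam b phi)]].

Lemma pull_over_a (Y : Type) (b' : Y -> C') : small K Y ->
  exists b, elequiv (env_sum a b) (env_sum (j \o a) b').
Proof.
move=> sY; have [b bP] := pull_back b' a monC sY sI jE.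
exists b; apply: (elequiv_sub (f := env_sum inr inl) bP).
  by apply/funext => -[].
by apply/funext => -[].
Qed.

Lemma heir_reparam k (phi : formula L (I + 'I_k)) b' b :
  elequiv (env_sum a b) (env_sum (j \o a) b') ->
  heir (reparam b' phi) <-> p (reparam b phi).
Proof.
move=> bb'; split=> [[k2 [phi2 [b2' [b2 [E e2 p2]]]]]|h]; last by exists k, phi, b', b.
have sk := small_ord monC.
have sY : small K ('I_k + 'I_k2).
  by apply: small_sum; [exact: monster_strong_limit monC|exact: sk|exact: sk].
have [y yP] := pull_over_a (env_sum b' b2') sY.
(* Both presentations are copied by one map [f] of parameters, which turns [E] into a syntactic
   identity over [C]. It is well defined because equality of types preserves coincidences among
   parameters. *)
have [f fP] : exists f : C' -> C, f \o env_sum b' b2' = y.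
  have [c0] := carrier_inhabited C.
  have /choice[f fP] c' : exists c, forall x, env_sum b' b2' x = c' -> y x = c.
    have [[x xc']|n] := pselect (exists x, env_sum b' b2' x = c').
      exists (y x) => x' x'c'.
      have := @elequiv_eq _ _ _ _ _ _ (inr x') (inr x) (elequiv_sym yP).
      by apply; rewrite /= x'c' xc'.
    by exists c0 => x xc'; case: n; exists x.
  by exists f; apply/funext => x /=; rewrite -(fP _ x).
have E' := congr1 (reparam f) E; rewrite !reparam_comp in E'.
have e1 : elequiv (env_sum a (f \o b')) (env_sum (j \o a) b').
  apply: (elequiv_sub (f := env_sum inl (inr \o inl)) yP).
    by rewrite -fP; apply/funext => -[].
  by apply/funext => -[].
have e3 : elequiv (env_sum a (f \o b2')) (env_sum (j \o a) b2').
  apply: (elequiv_sub (f := env_sum inl (inr \o inr)) yP).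
    by rewrite -fP; apply/funext => -[].
  by apply/funext => -[].
apply: (inv_type_elequiv phi (sk k) (elequiv_trans e1 (elequiv_sym bb'))).1.
rewrite E'.
exact: (inv_type_elequiv phi2 (sk k2) (elequiv_trans e2 (elequiv_sym e3))).1.
Qed.

Lemma heir_types : types (j \o a) heir.
Proof.
have [c0] := carrier_inhabited C'.
apply/typesE; split; first split.
- move=> n theta ht.
  have [k [b' [phi phiP]]] := formula_params_family c0 theta.
  have [b bP] := pull_over_a b' (small_ord monC k).
  have pphi l : p (reparam b (phi l)) by apply/(heir_reparam _ bP); rewrite -phiP.
  have [c cP] := pT.1 _ _ pphi.
  have [psi psiP] := ex_quant_family phi.
  have bb' : elequiv b b' by exact: (elequiv_comp inr bP).
  have [|c' c'P] := (psiP C' b').1.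
    apply/bb'/psiP; exists c => l; have := cP l.
    by rewrite sat_reparam.
  by exists c' => l; rewrite phiP sat_reparam.
- move=> theta; have [k [b' [phi ->]]] := formula_params c0 theta.
  have [b bP] := pull_over_a b' (small_ord monC k).
  rewrite -reparam_FNot !(heir_reparam _ bP).
  exact: pT.2.
- move=> phi /(elementary_elequiv a jE); case: pS => /typesE[_ pa] _ /pa h.
  have noI0 (i : 'I_0) : False by case: i.
  exists 0, (rename inl phi), (fun l => False_rect _ (noI0 l)),
    (fun l => False_rect _ (noI0 l)).
  split; first by rewrite /reparam rename_comp.
    apply: (elequiv_sub (f :=
      fun x : I + 'I_0 => match x with inl y => y | inr l => False_rect _ (noI0 l)
        end) (elementary_elequiv a jE)).
      by apply/funext => -[//|l]; case: (noI0 l).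
    by apply/funext => -[//|l]; case: (noI0 l).
  by rewrite /reparam rename_comp.
Qed.

Lemma heir_restrict : restrict_type j heir = p.
Proof.
have [c0] := carrier_inhabited C.
apply/funext => theta; apply/propext.
have [k [b [phi ->]]] := formula_params c0 theta.
rewrite /restrict_type /mkset reparam_comp.
apply: heir_reparam; have := elementary_elequiv (env_sum a b) jE.
by rewrite env_sum_comp.
Qed.

Lemma heir_invariant : fixes (j \o a \o s) heir.
Proof.
have [c0] := carrier_inhabited C'.
move=> g gfix; apply/funext => theta; apply/propext.
have [k [b' [phi ->]]] := formula_params c0 theta.
have sk := small_ord monC k.
have [b bP] := pull_over_a b' sk.
have [b2 b2P] := pull_over_a (aut_invfun g \o b') sk.
rewrite act_reparam (heir_reparam _ bP) (heir_reparam _ b2P).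
apply: (fixes_elequiv _ monC sV sk pfix).
have e1 : elequiv (env_sum (a \o s) b) (env_sum (j \o a \o s) b').
  apply: (elequiv_sub (f := env_sum (inl \o s) inr) bP); by apply/funext => -[].
have e2 : elequiv (env_sum (a \o s) b2) (env_sum (j \o a \o s) (aut_invfun g \o b')).
  apply: (elequiv_sub (f := env_sum (inl \o s) inr) b2P); by apply/funext => -[].
apply: (elequiv_trans e2); apply: elequiv_trans (elequiv_sym e1).
apply: elequiv_sym; have := elequiv_aut (aut_inv g) (env_sum (j \o a \o s) b').
rewrite env_sum_comp (_ : aut_inv g \o (j \o a \o s) = j \o a \o s) //.
apply/funext => x /=; rewrite -{1}(_ : g (j (a (s x))) = j (a (s x))) ?aut_funK //.
exact: (congr1 (@^~ x) gfix).
Qed.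

Lemma inv_extensionP :
  inv_types (j \o a) (j @` range (a \o s)) (inv_extension j a (range (a \o s)) p) /\
  restrict_type j (inv_extension j a (range (a \o s)) p) = p.
Proof.
apply: (@xgetPex _ set0 [set p' | inv_types (j \o a) (j @` range (a \o s)) p' /\
  restrict_type j p' = p]).
exists heir; split; last exact: heir_restrict.
split; first exact: heir_types.
have -> : j @` range (a \o s) = range (j \o a \o s).
  by rewrite image_comp.
exact/invariantE/heir_invariant.
Qed.

(** Uniqueness of the invariant extension: invariance and the restriction [p] force its value on
    [b'], so the choice hidden in [inv_extension] is harmless. *)
Lemma inv_extension_reparam k (phi : formula L (I + 'I_k)) b' b :
  elequiv (env_sum a b) (env_sum (j \o a) b') ->
  inv_extension j a (range (a \o s)) p (reparam b' phi) <-> p (reparam b phi).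
Proof.
move=> bb'; have [[_ inv] restr] := inv_extensionP.
rewrite -{2}restr /restrict_type /mkset reparam_comp.
have {}inv : fixes (j \o a \o s) (inv_extension j a (range (a \o s)) p).
  by apply/invariantE; rewrite image_comp in inv.
apply: (fixes_elequiv _ monC' sI' (small_ord monC' k)); first exact: fixes_comp inv.
apply: (elequiv_trans (elequiv_sym bb')).
have := elementary_elequiv (env_sum a b) jE.
by rewrite env_sum_comp.
Qed.

Lemma star_reparam q k (phi : formula L (I + 'I_k)) b b1 :
  types a q -> link q b b1 ->
  star j a (range (a \o s)) p q (reparam b phi) <-> p (reparam b1 phi).
Proof.
move=> qT; have qE := realizerP qT; rewrite {1}qE link_tp => bb1.
set sigma := realizer j a q in qE bb1.
rewrite /star /restrict_type /mkset reparam_comp act_reparam.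
apply: inv_extension_reparam; apply: (elequiv_trans bb1).
have := elequiv_aut (aut_inv sigma) (env_sum (sigma \o j \o a) (j \o b)).
rewrite env_sum_comp (_ : aut_inv sigma \o (sigma \o j \o a) = j \o a) //.
by apply/funext => x /=; rewrite aut_funK.
Qed.

End InvariantExtension.
End Star.

(** * Bounded orbits *)

Section BoundedOrbits.
Variables (L : language) (K : Type) (C M : structure L) (I : Type).
Hypotheses (monC : monster K C) (sM : small K M).
Variables (i : M -> C) (iE : elementary i).
Implicit Types (p r : set (formula L (I + C))) (g : aut C).

Lemma orbit_act p r g : orbit_type p r -> orbit_type p (act g r).
Proof. by move=> [h _ <-]; rewrite act_mul; exists (aut_mul g h). Qed.

Lemma orbit_refl p : orbit_type p p.
Proof. by exists (aut_one C) => //; exact: act_one. Qed.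

Lemma type_ext p r :
  (forall k (phi : formula L (I + 'I_k)) (b : 'I_k ->
    C), p (reparam b phi) <-> r (reparam b phi)) ->
  p = r.
Proof.
have [c0] := carrier_inhabited C.
move=> pr; apply/funext => theta; apply/propext.
by have [k [b [phi ->]]] := formula_params c0 theta; exact: pr.
Qed.

(* The values of [y |-> {r in the orbit | phi(x, y) in r}] form a small set, so
   [b*] realizing a coheir of [tp(b/M)] over [M], [b], [b'] and representatives
   of these values has the same value as some [y] with [tp(y b* ) = tp(b b* ) =
   tp(b' b* )]. *)
Lemma bounded_orbit_elequiv p r k (phi : formula L (I + 'I_k)) (b b' : 'I_k -> C) :
  card_lt (orbit_type p) [set: K] -> orbit_type p r ->
  elequiv (env_sum i b) (env_sum i b') ->
  r (reparam b phi) <-> r (reparam b' phi).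
Proof.
move=> /card_lt_small sO Or bb'.
pose O : Type := orbit_type p.
pose f (y : 'I_k -> C) : set O := [set r | val r (reparam y phi)].
have /choice[rep repP] v : exists y, elequiv (env_sum i y) (env_sum i b) /\
    ((exists2 y', elequiv (env_sum i y') (env_sum i b) & f y' = v) -> f y = v).
  have [[y' y'b fy']|n] :=
    pselect (exists2 y', elequiv (env_sum i y') (env_sum i b) & f y' = v).
    by exists y'.
  by exists b.
pose E (x : bool + set O) : 'I_k -> C :=
  match x with inl true => b | inl false => b' | inr v => rep v end.
have Eb x : elequiv (env_sum i (E x)) (env_sum i b).
  by case: x => [[]|v] //=; [exact: elequiv_sym|have [] := repP v].
pose d : M + (bool + set O) * 'I_k -> C := env_sum i (fun x => E x.1 x.2).
have [U [UU UP]] := coheir_ultra iE b.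
have K_lim := monster_strong_limit monC.
have sW : small K (M + (bool + set O) * 'I_k).
  apply: small_sum => //; apply: small_prod => //; last exact: small_ord monC k.
  by apply: small_sum => //; [exact: small_bool monC|exact: small_set].
have [bs bsP] := realize_ctype monC (small_ord monC k) sW
  (ctype_ultra d (fun w : 'I_k -> M => i \o w) UU).
have bsb : elequiv (env_sum i bs) (env_sum i b).
  apply: elequiv_sym; apply: elequiv_imp => psi h.
  pose psi' : formula L ('I_k + M) := rename (env_sum inr inl) psi.
  have /UP : sat C psi' (env_sum b i).
    by rewrite sat_rename (_ : env_sum b i \o _ = env_sum i b) //; apply/funext => -[].
  have -> : [set w | sat C psi' (env_sum (i \o w) i)] =
      [set w | sat C (rename (env_sum inl (inr \o inl)) psi') (env_sum (i \o w) d)].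
    by apply/funext => w; rewrite /mkset sat_rename env_sum_comp.
  move/bsP; rewrite /psi' !sat_rename.
  by congr (sat C _ _); apply/funext => -[].
have Ebs x y : elequiv (env_sum (E x) bs) (env_sum (E y) bs).
  move=> psi.
  pose rn (x : bool + set O) : formula L ('I_k + (M + (bool + set O) * 'I_k)) :=
    rename (env_sum (fun l => inr (inr (x, l))) inl) psi.
  have rnP z : sat C (rn z) (env_sum bs d) = sat C psi (env_sum (E z) bs).
    by rewrite sat_rename env_sum_comp.
  have rnE z w : sat C (rn z) (env_sum (i \o w) d) = sat C psi (env_sum (E z) (i \o w)).
    by rewrite sat_rename env_sum_comp.
  rewrite -!rnP -!bsP /mkset.
  have -> // : (fun w => sat C (rn x) (env_sum (i \o w) d)) = (fun w => sat C (rn y)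
    (env_sum (i \o w) d)).
  apply/funext => w; apply/propext; rewrite !rnE.
  have xy := elequiv_trans (Eb x) (elequiv_sym (Eb y)).
  have e : elequiv (env_sum (E x) (i \o w)) (env_sum (E y) (i \o w)).
    by apply: (elequiv_sub (f := env_sum inr (inl \o w)) xy); apply/funext => -[].
  exact: e.
have fbs : f (rep (f bs)) = f bs by apply: (repP (f bs)).2; exists bs.
(* The orbit is closed under [g^-1], so [fbs] evaluated at [g^-1 r'] compares [r'] at
   [g \o rep (f bs) = E x] with [r'] at [g \o bs = bs]. *)
have main x r' : orbit_type p r' -> r' (reparam (E x) phi) <-> r' (reparam bs phi).
  move=> Or'.
  have skk : small K ('I_k + 'I_k) by apply: small_sum => //; exact: small_ord monC k.
  have [g gE] := homogeneous_aut monC skk (Ebs (inr (f bs)) x).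
  have gy : g \o rep (f bs) = E x by apply/funext => l; exact: (congr1 (@^~ (inl l)) gE).
  have gbs : g \o bs = bs by apply/funext => l; exact: (congr1 (@^~ (inr l)) gE).
  have Or2 := orbit_act (aut_inv g) Or'.
  have := congr1 (fun F : set O => F (SigSub (mem_set Or2))) fbs.
  rewrite /f /mkset /= !act_reparam /=.
  by rewrite gy gbs => ->.
by rewrite (main (inl true) _ Or) (main (inl false) _ Or).
Qed.

Lemma bounded_orbit_fixes p g :
  card_lt (orbit_type p) [set: K] -> fixes i (act g p).
Proof.
move=> sO h hi; apply: type_ext => k phi b; rewrite act_reparam.
apply: bounded_orbit_elequiv sO _ _; first exact/orbit_act/orbit_refl.
have := elequiv_aut h (env_sum i (aut_invfun h \o b)).
rewrite env_sum_comp hi (_ : h \o (aut_invfun h \o b) = b) //.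
by apply/funext => l /=; rewrite aut_invfunK.
Qed.

(** If [h] fixes [M] and carries [g \o i] to [g' \o i], then it fixes [g p], while [g'^-1 h g] fixes
    [M] and hence [p]. *)
Lemma act_eq p g g' : fixes i p -> fixes i (act g p) ->
  elequiv (env_sum (g \o i) i) (env_sum (g' \o i) i) -> act g p = act g' p.
Proof.
move=> pi gpi e.
have sMM : small K (M + M) by apply: small_sum => //; exact: monster_strong_limit monC.
have [h hE] := homogeneous_aut monC sMM e.
have hi : h \o i = i by apply/funext => l; exact: (congr1 (@^~ (inr l)) hE).
rewrite -[LHS](gpi _ hi).
have /pi : aut_mul (aut_inv g') (aut_mul h g) \o i = i.
  apply/funext => l /=; have /= -> := congr1 (@^~ (inl l)) hE.
  by rewrite aut_funK.
by rewrite -!act_mul => /(congr1 (act g')); rewrite actVK.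
Qed.

Lemma fixes_bounded_orbit p : (forall g, fixes i (act g p)) ->
  card_lt (orbit_type p) [set: K].
Proof.
move=> fixp; apply/card_lt_small.
have pi : fixes i p by rewrite -(act_one p).
have [m0] := carrier_inhabited M.
have sMM : small K (M + M) by apply: small_sum => //; exact: monster_strong_limit monC.
have sF := small_set (monster_strong_limit monC)
  (small_formula monC (inhabits (inl m0 : M + M)) sMM).
have /choice[G GP] (r : orbit_type p) : exists g, act g p = val r.
  by have [g _ <-] := set_valP r; exists g.
pose tpM (r : orbit_type p) : set (formula L (M + M)) :=
  [set psi | sat C psi (env_sum (G r \o i) i)].
apply: small_inj sF; apply: (_ : injective tpM).
move=> r r' e; apply: val_inj; rewrite -(GP r) -(GP r').
by apply: act_eq => // psi; have :=
  congr1 (fun F : set (formula L (M + M)) => F psi) e; rewrite /tpM /mkset => ->.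
Qed.

End BoundedOrbits.

(** * The semigroup of invariant types *)

Section InvariantSemigroup.
Variables (L : language) (K K' : Type) (C C' M : structure L).
Hypotheses (monC : monster K C) (monC' : monster K' C').
Variables (j : C -> C') (jE : elementary j).
Variables (I : Type) (a : I -> C) (s : M -> I).
Hypotheses (sI : small K I) (sI' : small K' I) (sC : small K' C) (sM : small K M).
Local Notation i := (a \o s).
Hypothesis iE : elementary i.

Local Notation S := (inv_types a (range i)).
Local Notation op := (star j a (range i)).
Local Notation fgen := (fGen K a (range i)).
Implicit Types (p q r : set (formula L (I + C))) (g : aut C).

Lemma inv_typesE p : S p <-> types a p /\ fixes i p.
Proof. split=> -[pT pI]; split=> //; exact/invariantE. Qed.

Lemma fGenP p : fgen p <-> forall g, S (act g p).
Proof.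
split=> [[pS pO] g|h].
  apply/inv_typesE; split; first by apply: act_types; case: pS.
  exact: bounded_orbit_fixes pO.
split; first by rewrite -(act_one p).
apply: (fixes_bounded_orbit monC sM (i := i)) => g; have [_ hi] := h g; exact/invariantE.
Qed.

Lemma fGen_inv p : fgen p -> S p.
Proof. by case. Qed.

Lemma fGen_act g p : fgen p -> fgen (act g p).
Proof. by rewrite !fGenP => h g'; rewrite act_mul. Qed.

Lemma star_spec p q k (phi : formula L (I + 'I_k)) b b1 : S p ->
  types a q -> link a q b b1 -> op p q (reparam b phi) <-> p (reparam b1 phi).
Proof. by move=> pS; exact: (star_reparam monC monC' jE sI sI' sC sM pS). Qed.

Lemma act_link q g k (b b1 : 'I_k -> C) :
  link a (act g q) b b1 <-> link a q (aut_invfun g \o b) b1.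
Proof. by split=> h psi; have := h psi; rewrite act_reparam. Qed.

Lemma act_star p q g : S p -> types a q -> act g (op p q) = op p (act g q).
Proof.
move=> pS qT; apply: type_ext => k phi b; rewrite act_reparam.
have [b1 b1P] := link_ex monC sI (aut_invfun g \o b) qT (small_ord monC k).
rewrite (star_spec phi pS qT b1P) (@star_spec _ _ _ _ _ b1) //.
  exact: act_types.
exact/act_link.
Qed.

Lemma star_types p q : S p -> types a q -> types a (op p q).
Proof.
move=> pS qT.
have /typesE[pT pa] := pS.1; have /typesE[qT' _] := qT.
have [c0] := carrier_inhabited C.
apply/typesE; split; first split.
- move=> n theta h; have [k [b [phi phiP]]] := formula_params_family c0 theta.
  have [b1 b1P] := link_ex monC sI b qT (small_ord monC k).
  have ph l : p (reparam b1 (phi l)) by apply/(star_spec _ pS qT b1P); rewrite -phiP.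
  have [c cP] := pT.1 _ _ ph.
  have [chi chiP] := ex_quant_family phi.
  (* [b1] and [b] have the same type over the empty set, because a formula in the parameters alone
     lies in [q] iff it holds in [C]. *)
  have [|c' c'P] := (chiP C b).1.
    have := b1P (rename inr chi); rewrite sat_rename /reparam rename_comp.
    rewrite (_ : _ \o inr = inr \o b) // -rename_comp (ctype_param qT') sat_rename => <-.
    by apply/chiP; exists c => l; have := cP l; rewrite sat_reparam.
  by exists c' => l; rewrite phiP sat_reparam.
- move=> theta; have [k [b [phi ->]]] := formula_params c0 theta.
  have [b1 b1P] := link_ex monC sI b qT (small_ord monC k).
  by rewrite -reparam_FNot !(star_spec _ pS qT b1P); exact: pT.2.
- move=> phi /pa ph.
  have noI0 (l : 'I_0) : False by case: l.
  have E (b : 'I_0 -> C) : rename inl phi = reparam b (rename inl phi).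
    by rewrite /reparam rename_comp.
  have [b1 b1P] := link_ex monC sI (fun l => False_rect C (noI0 l)) qT (small_ord monC 0).
  by rewrite (E (fun l => False_rect C (noI0 l))) (star_spec _ pS qT b1P) -E.
Qed.

Lemma star_inv p q : S p -> S q -> S (op p q).
Proof.
move=> pS /inv_typesE[qT qi]; apply/inv_typesE; split; first exact: star_types.
by move=> g gi; rewrite act_star // qi.
Qed.

Definition conj_realizes q g := forall psi : formula L (I + M),
  sat C psi (env_sum (g \o a) i) <-> q (reparam i psi).

(** By [act_eq] one may replace [g], separately for each [b], by some [g1] such that [g1 \o a]
    realizes [q] over [M] and [b] together. Then [b1] and [g1^-1 b] have the same type over [a], so
    [p] does not separate them. *)
Lemma star_conj p q g : fgen p -> types a q -> conj_realizes q g -> op p q = act g p.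
Proof.
move=> pF qT gq; have pS := fGen_inv pF.
have K_lim := monster_strong_limit monC.
have /typesE[qT' qa] := qT.
apply: type_ext => k phi b; have sk := small_ord monC k.
have [b1 b1P] := link_ex monC sI b qT sk.
rewrite (star_spec _ pS qT b1P).
pose d := env_sum i b.
have sMk : small K (M + 'I_k) by exact: small_sum.
have [c cP] := realize_ctype monC sI sMk (ctype_reparam qT' d).
have ac : elequiv a c.
  apply: elequiv_imp => psi /qa h.
  have /cP : q (reparam d (rename inl psi)) by rewrite /reparam rename_comp.
  by rewrite sat_rename.
have [g1 g1P] := homogeneous_aut monC sI ac.
have -> : act g p = act g1 p.
  apply: (act_eq monC sM (i := i)).
  - by have /inv_typesE[] := pS.
  - by have /fGenP/(_ g)/inv_typesE[] := pF.
  - have e : elequiv (env_sum (g \o a) i) (env_sum (g1 \o a) i).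
      move=> psi; rewrite gq.
      have -> : reparam i psi = reparam d (reparam inl psi).
        by rewrite reparam_comp.
      have := cP (reparam inl psi); rewrite /mkset sat_reparam g1P => ->.
      by [].
    by apply: (elequiv_sub (f := env_sum (inl \o s) inr) e); apply/funext => -[].
rewrite act_reparam.
apply: (inv_type_elequiv monC sI pS phi sk).
have e : elequiv (env_sum a b1) (env_sum (g1 \o a) b).
  move=> psi; rewrite b1P.
  have -> : reparam b psi = reparam d (reparam inr psi).
    by rewrite reparam_comp.
  have := cP (reparam inr psi); rewrite /mkset sat_reparam g1P => ->.
  by [].
apply: (elequiv_trans e).
have := elequiv_aut (aut_inv g1) (env_sum (g1 \o a) b).
rewrite env_sum_comp (_ : aut_inv g1 \o (g1 \o a) = a) //.
by apply/funext => l /=; rewrite aut_funK.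
Qed.

Lemma conj_realizes_exists q : types a q -> exists g, conj_realizes q g.
Proof.
move=> qT; have /typesE[qT' qa] := qT.
have [c cP] := realize_ctype monC sI sM (ctype_reparam qT' i).
have ac : elequiv a c.
  apply: elequiv_imp => psi /qa h.
  have /cP : q (reparam i (rename inl psi)) by rewrite /reparam rename_comp.
  by rewrite sat_rename.
have [g gP] := homogeneous_aut monC sI ac.
by exists g => psi; rewrite gP -cP.
Qed.

(** A coheir of the type of [g \o a] over [M] is [M]-invariant, because automorphisms fixing [M] fix
    the tuples that it averages. *)
Lemma conj_realizes_surj g : exists2 q, S q & conj_realizes q g.
Proof.
have [U [UU UP]] := coheir_ultra iE (g \o a).
have qT := ctype_ultra id (fun w : I -> M => i \o w) UU.
set q := (X in ctype _ X) in qT.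
have gq psi : sat C psi (env_sum (g \o a) i) -> q (reparam i psi).
  move=> /UP; rewrite /q /mkset; apply: filterS => w.
  by rewrite /mkset sat_reparam.
exists q.
  apply/inv_typesE; split.
    apply/typesE; split=> // phi /(elequiv_aut g a) h.
    have := gq (rename inl phi); rewrite sat_rename /reparam rename_comp.
    exact.
  move=> h hi; apply/funext => theta.
  rewrite /act /q /mkset; congr U; apply/funext => w; rewrite /mkset sat_reparam.
  apply/propext; have := elequiv_aut h (env_sum (i \o w) (id \o aut_inv h)) theta.
  rewrite env_sum_comp (_ : h \o (i \o w) = i \o w); last by rewrite compA hi.
  rewrite (_ : h \o (id \o aut_inv h) = id) //.
  by apply/funext => x /=; rewrite aut_invfunK.
move=> psi; split; first exact: gq.
move=> qpsi; apply: contrapT => /(gq (FNot psi)).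
by rewrite reparam_FNot (ctype_FNot qT).
Qed.

Lemma star_orbit p : fgen p -> [set op p q | q in S] = orbit_type p.
Proof.
move=> pF; apply/seteqP; split=> [_ [q [qT _] <-]|_ [g _ <-]].
  by have [g gq] := conj_realizes_exists qT; rewrite (star_conj pF qT gq); exists g.
by have [q qS gq] := conj_realizes_surj g; exists q => //; apply: star_conj => //;
  case: qS.
Qed.

Lemma fGen_orbit p r : fgen p -> orbit_type p r -> fgen r.
Proof. by move=> pF [g _ <-]; exact: fGen_act. Qed.

Lemma orbit_eq p r : orbit_type p r -> orbit_type r = orbit_type p.
Proof.
move=> [g _ <-]; apply/seteqP; split=> _ [h _ <-].
  by rewrite act_mul; exists (aut_mul h g).
by exists (aut_mul h (aut_inv g)) => //; rewrite -act_mul actK.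
Qed.

(** With [g \o a] realizing [p] over [M] and [u = g^-1 p], one gets
    [u * u = g^-1 (u * p) = g^-1 (g u) = u]. *)
Lemma fGen_idempotent p : fgen p -> exists2 u, orbit_type p u & op u u = u.
Proof.
move=> pF; have pT : types a p by case: (fGen_inv pF).
have [g gp] := conj_realizes_exists pT.
have uF := fGen_act (aut_inv g) pF.
exists (act (aut_inv g) p); first by exists (aut_inv g).
rewrite -act_star //; last exact: fGen_inv.
by rewrite (star_conj uF pT gp) actVK.
Qed.

Lemma idempotent_star p u : fgen u -> op u u = u -> orbit_type u p -> op u p = p.
Proof.
move=> uF uu [g _ <-]; have uS := fGen_inv uF.
by rewrite -act_star ?uu //; case: uS.
Qed.

Lemma fGen_two_sided : fgen !=set0 -> two_sided_ideal S op fgen.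
Proof.
move=> fgen0; have fS : fgen `<=` S by move=> p; exact: fGen_inv.
split; split=> // p q.
- move=> pS qF; have qS := fGen_inv qF; apply/fGenP => g.
  rewrite act_star //; last by case: qS.
  by apply: star_inv => //; move/fGenP: qF; exact.
- move=> pF [qT _]; have [g gq] := conj_realizes_exists qT.
  by rewrite (star_conj pF qT gq); exact: fGen_act.
Qed.

(** If [g \o a] realizes over [M] some [p] in [F], then every f-generic [q] is the left multiple
    [(g^-1 q) * p] of [p]. *)
Lemma fGen_sub_left_ideal F : left_ideal S op F -> fgen `<=` F.
Proof.
move=> [[p Fp] FS Fop] q qF; have pT : types a p by case: (FS _ Fp).
have [g gp] := conj_realizes_exists pT.
have rF := fGen_act (aut_inv g) qF.
have := Fop _ _ (fGen_inv rF) Fp.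
by rewrite (star_conj rF pT gp) actVK.
Qed.

Lemma fGen_minimal : fgen !=set0 -> minimal_left_ideal S op fgen.
Proof.
move=> fgen0; split; first by case: (fGen_two_sided fgen0).
by move=> F Fl FF; apply/seteqP; split=> //; exact: fGen_sub_left_ideal.
Qed.

Lemma minimal_left_unique F : fgen !=set0 -> minimal_left_ideal S op F -> F = fgen.
Proof.
move=> fgen0 [Fl Fmin]; apply/esym/Fmin; last exact: fGen_sub_left_ideal.
by case: (fGen_two_sided fgen0).
Qed.

Lemma idempotent_orbit u : fgen u -> op u u = u ->
  [set op u q | q in fgen] = orbit_type u.
Proof.
move=> uF uu; apply/seteqP; split=> [_ [q qF <-]|p up].
  by rewrite -star_orbit //; exists q => //; exact: fGen_inv.
exists p; first exact: fGen_orbit up.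
exact: idempotent_star up.
Qed.

Lemma Ellis_groupP E : fgen !=set0 ->
  Ellis_group S op E <-> exists2 p, fgen p & E = orbit_type p.
Proof.
move=> fgen0; split=> [[F [u [Fmin Fu uu ->]]]|[p pF ->]].
  have FE := minimal_left_unique fgen0 Fmin; subst F.
  by exists u => //; exact: idempotent_orbit.
have [u pu uu] := fGen_idempotent pF; have uF := fGen_orbit pF pu.
exists fgen, u; split=> //; first exact: fGen_minimal.
by rewrite idempotent_orbit // (orbit_eq pu).
Qed.

Lemma orbit_minimal_right p : fgen p -> minimal_right_ideal S op (orbit_type p).
Proof.
move=> pF; split.
  split; first by exists p; exact: orbit_refl.
    by move=> r /(fGen_orbit pF)/fGen_inv.
  move=> r q pr qS; rewrite -(orbit_eq pr) -star_orbit; last exact: fGen_orbit pr.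
  by exists q.
move=> F [[r Fr] FS Fop] FO; apply/seteqP; split=> //.
have pr := FO _ Fr; rewrite -(orbit_eq pr) -star_orbit; last exact: fGen_orbit pr.
by move=> _ [q qS <-]; exact: Fop.
Qed.

End InvariantSemigroup.

(** * Keisler measures *)

Import Order.TTheory GRing.Theory Num.Theory.

Section Measure.
Local Open Scope ring_scope.
Variables (R : realType) (L : language) (C : structure L) (J : Type) (a : J -> C).
Variable mu : set (set (formula L (J + C))) -> R.
Hypothesis mu_measure : Keisler_measure a mu.
Implicit Types (theta chi xi : formula L (J + C)).

Local Notation holds theta c := (sat C theta (env_sum c id)).

Definition weight theta : R := mu (clopen a theta).

Lemma weight_ge0 theta : 0 <= weight theta.
Proof. exact: Keisler_ge0. Qed.

Lemma weight_add xi theta chi :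
  (forall c, holds xi c <-> holds theta c \/ holds chi c) ->
  (forall c, holds theta c -> ~ holds chi c) ->
  weight xi = weight theta + weight chi.
Proof.
move=> xiE disj; rewrite /weight -(Keisler_additive mu_measure); last first.
  apply/seteqP; split=> // p [[/typesE[pT _] pt] [_ pc]].
  have [c] := ctype_ex pT ((ctype_FAnd pT _ _).2 (conj pt pc)).
  by rewrite sat_FAnd => -[/disj].
congr mu; apply/seteqP; split=> [p [pa pxi]|p [[pa pt]|[pa pc]]]; last 2 first.
- by split=> //; have /typesE[pT _] :=
  pa; apply: (ctype_imp pT pt) => c h; apply/xiE; left.
- by split=> //; have /typesE[pT _] :=
  pa; apply: (ctype_imp pT pc) => c h; apply/xiE; right.
have [pt|npt] := pselect (p theta); [by left|right; split=> //].
have /typesE[pT _] := pa; move/(ctype_FNot pT): npt => npt.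
apply: (ctype_imp pT ((ctype_FAnd pT _ _).2 (conj pxi npt))) => c.
by rewrite sat_FAnd => -[/xiE[ht hn|//]]; case: (hn ht).
Qed.

Lemma weight_clopen0 theta : clopen a theta = set0 -> weight theta = 0.
Proof.
move=> t0; have := Keisler_additive mu_measure (theta := theta) (psi := theta).
rewrite setIid setUid t0 /weight t0 => /(_ erefl) /eqP.
by rewrite -subr_eq0 opprD addrA subrr sub0r oppr_eq0 => /eqP.
Qed.

Lemma weight_false theta : (forall c, ~ holds theta c) -> weight theta = 0.
Proof.
move=> n; apply: weight_clopen0; apply/seteqP; split=> // p [/typesE[pT _]].
by move=> /(ctype_ex pT)[c /n].
Qed.

Lemma weight_le theta chi : (forall c, holds theta c -> holds chi c) ->
  weight theta <= weight chi.
Proof.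
move=> h; rewrite (@weight_add chi theta (FAnd chi (FNot theta))).
- by rewrite lerDl weight_ge0.
- move=> c; rewrite sat_FAnd; split=> [hc|[/h|[]]] //.
  by have [|] := pselect (holds theta c); [left|right].
- by move=> c ht; rewrite sat_FAnd => -[_]; apply.
Qed.

Lemma weight_eq theta chi : (forall c, holds theta c <-> holds chi c) ->
  weight theta = weight chi.
Proof. by move=> h; apply/le_anti/andP; split; apply: weight_le => c; rewrite h. Qed.

Lemma weight_true theta : (forall c, holds theta c) -> weight theta = 1.
Proof.
move=> h; rewrite -(Keisler_total mu_measure); congr mu.
apply/seteqP; split=> [p []//|p pa]; split=> //.
by have /typesE[pT _] := pa; exact: (ctype_all pT h).
Qed.

Lemma weight_sub xi theta chi :
  (forall c, holds xi c -> holds theta c \/ holds chi c) ->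
  weight xi <= weight theta + weight chi.
Proof.
move=> h; rewrite (@weight_add xi (FAnd xi theta) (FAnd xi (FNot theta))).
- apply: lerD; apply: weight_le => c; rewrite sat_FAnd => -[hx ht] //.
  by have [/ht|] := h _ hx.
- move=> c; rewrite !sat_FAnd; split=> [hx|[[]|[]]] //.
  by have [|] := pselect (holds theta c); [left|right].
- by move=> c; rewrite !sat_FAnd => -[_ ht] [_]; apply.
Qed.

Lemma weight_pos_sat theta : 0 < weight theta -> exists c, holds theta c.
Proof. by move=> h; apply: contrapT => /forallNP/weight_false h0;
  rewrite h0 ltxx in h. Qed.

(** The union [G n] of the first [n] events has weight [n] times [delta], which is at most 1, and
    the reals are Archimedean. *)
Lemma weight_aedisjoint (E : nat -> formula L (J + C)) (delta : R) :
  (forall n, weight (E n) = delta) ->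
  (forall m n, (m < n)%N -> weight (FAnd (E m) (E n)) = 0) ->
  delta <= 0.
Proof.
move=> Edelta Edisj.
pose G := fix G n : formula L (J + C) :=
  if n is m.+1 then FNot (FAnd (FNot (G m)) (FNot (E m))) else FFalse.
have GS n c : holds (G n.+1) c <-> holds (G n) c \/ holds (E n) c.
  rewrite [G n.+1]/= sat_FNot sat_FAnd !sat_FNot.
  split=> [h|[h [h' _]|h [_ h']]] //.
  have [|n1] := pselect (holds (G n) c); [by left|right].
  by apply: contrapT => n2; exact: h.
have GE n m : (n <= m)%N -> weight (FAnd (G n) (E m)) = 0.
  elim: n => [|n IH] nm; first by apply: weight_false => c; rewrite sat_FAnd => -[].
  apply/le_anti; rewrite weight_ge0 andbT.
  have := @weight_sub (FAnd (G n.+1) (E m)) (FAnd (G n) (E m)) (FAnd (E n) (E m)).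
  rewrite (IH (ltnW nm)) (Edisj _ _ nm) addr0; apply=> c.
  by rewrite !sat_FAnd => -[/GS[] ? ?]; [left|right].
have Gn n : weight (G n) = delta *+ n.
  elim: n => [|n IH]; first by rewrite mulr0n; apply: weight_false => c [].
  rewrite (@weight_add (G n.+1) (G n) (FAnd (E n) (FNot (G n)))).
  - rewrite IH mulrSr; congr (_ + _); rewrite -(Edelta n).
    rewrite (@weight_add (E n) (FAnd (G n) (E n)) (FAnd (E n) (FNot (G n)))).
    + by rewrite GE // add0r.
    + move=> c; rewrite !sat_FAnd; split=> [he|[[]|[]]] //.
      by have [|] := pselect (holds (G n) c); [left|right].
    + by move=> c; rewrite !sat_FAnd => -[hg _] [_]; apply.
  - move=> c; rewrite GS sat_FAnd; split=> [[|he]|[|[]]]; try by [left|right].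
    by have [|] := pselect (holds (G n) c); [left|right].
  - by move=> c hg; rewrite sat_FAnd => -[_]; apply.
have le1 n : delta *+ n <= 1.
  rewrite -Gn; have <- : weight (FNot FFalse) = 1 by apply: weight_true => c [].
  by apply: weight_le => c _ [].
rewrite leNgt; apply/negP => delta0.
have := archi_boundP (ltW (divr_gt0 ltr01 delta0)).
set n := (X in X%:R); rewrite ltr_pdivrMr // mulr_natl => /lt_le_trans/(_ (le1 n)).
by rewrite ltxx.
Qed.

Hypothesis mu_inv : forall (g : aut C) theta,
  mu [set act g p | p in clopen a theta] = mu (clopen a theta).

Lemma weight_reparam (g : aut C) theta : weight (reparam g theta) = weight theta.
Proof.
rewrite /weight -(mu_inv g theta); congr mu; apply/seteqP;
  split=> [p [pa pt]|_ [p [pa pt] <-]].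
  exists (act (aut_inv g) p); last exact: actVK.
  split; [exact: act_types|rewrite /act /mkset].
  by rewrite (_ : aut_inv (aut_inv g) = g :> (C -> C)).
split; first exact: act_types.
rewrite act_reparam (_ : aut_invfun g \o g = id) ?reparam_id //.
by apply/funext => x /=; rewrite aut_funK.
Qed.

End Measure.

(** * Morley sequences of a coheir *)

Lemma increasing_lt (t : nat -> nat) : (forall l, t l < t l.+1) ->
  forall m n, m < n -> t m < t n.
Proof.
move=> tS m; elim=> // n IH; rewrite ltnS leq_eqVlt => /orP[/eqP <- //|/IH h].
exact: ltn_trans (tS n).
Qed.

Section Morley.
Variables (L : language) (K : Type) (C M : structure L).
Hypotheses (monC : monster K C) (sM : small K M).
Variables (i : M -> C) (iE : elementary i) (k : nat).
Variables (U : set_system ('I_k -> M)) (UU : UltraFilter U).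

Definition coheir (W : Type) (d : W -> C) : set (formula L ('I_k + W)) :=
  [set theta | U [set w | sat C theta (env_sum (i \o w) d)]].

Lemma coheir_ctype (W : Type) (d : W -> C) : ctype d (coheir d).
Proof. exact: (ctype_ultra d (fun w : 'I_k -> M => i \o w)). Qed.

Lemma coheir_invariant (W : Type) (d d' : W -> C) theta :
  elequiv (env_sum i d) (env_sum i d') -> coheir d theta <-> coheir d' theta.
Proof.
move=> dd'; rewrite /coheir /mkset.
have -> // : (fun w => sat C theta (env_sum (i \o w) d)) = (fun w => sat C theta
  (env_sum (i \o w) d')).
apply/funext => w; apply/propext.
have e : elequiv (env_sum (i \o w) d) (env_sum (i \o w) d').
  by apply: (elequiv_sub (f := env_sum (inl \o w) inr) dd'); apply/funext => -[].
exact: e.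
Qed.

Lemma coheir_reparam (W W' : Type) (f : W -> W') (d : W' -> C) theta :
  coheir d (reparam f theta) <-> coheir (d \o f) theta.
Proof.
rewrite /coheir /mkset.
have -> // : (fun w => sat C (reparam f theta) (env_sum (i \o w) d)) = (fun w => sat
  C theta (env_sum (i \o w) (d \o f))).
by apply/funext => w; rewrite sat_reparam.
Qed.

Definition prefix_env (A : nat -> 'I_k -> C) (n : nat) : M + 'I_n * 'I_k -> C :=
  env_sum i (fun x : 'I_n * 'I_k => A x.1 x.2).

Arguments prefix_env A n z : clear implicits.

Definition Morley (A : nat -> 'I_k -> C) : Prop :=
  forall n theta, coheir (prefix_env A n) theta <-> sat C theta (env_sum (A n)
    (prefix_env A n)).

(** By induction on [n]: the next term realizes an [M]-invariant type, so its type over the earlier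
    terms depends only on their type over [M], and gaps in the sequence do not show. *)
Lemma Morley_indiscernible A (t : nat -> nat) n : Morley A -> (forall l, t l < t l.+1) ->
  elequiv (prefix_env (A \o t) n) (prefix_env A n).
Proof.
move=> AM tS; elim: n => [|n IH].
  have -> : prefix_env (A \o t) 0 = prefix_env A 0 by apply/funext => -[//|[[]]].
  exact: elequiv_refl.
move=> phi.
pose f (x : M + 'I_n.+1 * 'I_k) : 'I_k + (M + 'I_n * 'I_k) :=
  match x with inl m => inr (inl m)
  | inr x => if unlift ord_max x.1 is Some l then inr (inr (l, x.2)) else inl x.2 end.
have fP B : prefix_env B n.+1 = env_sum (B n) (prefix_env B n) \o f.
  apply/funext => -[//|[l x]] /=.
  by case: (unliftP ord_max l) => [l'|] -> //=; rewrite /bump leqNgt ltn_ord.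
have tlt (l : 'I_n) : t l < t n by exact: increasing_lt.
pose h (x : M + 'I_n * 'I_k) : M + 'I_(t n) * 'I_k :=
  match x with inl m => inl m | inr x => inr (Ordinal (tlt x.1), x.2) end.
have hP : prefix_env (A \o t) n = prefix_env A (t n) \o h by apply/funext => -[].
rewrite !fP -!sat_rename -AM -(coheir_invariant _ (d :=
  prefix_env (A \o t) n)); last first.
  by apply: (elequiv_sub (f := env_sum inl id) IH); apply/funext => -[].
by rewrite hP -coheir_reparam AM sat_reparam.
Qed.

Lemma Morley_aut A (t : nat -> nat) n : Morley A -> (forall l, t l < t l.+1) ->
  exists g : aut C, forall l, l < n -> g \o A (t l) = A l.
Proof.
move=> AM tS.
have sW : small K (M + 'I_n * 'I_k).
  have K_lim := monster_strong_limit monC.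
  by apply: small_sum => //; apply: small_prod => //; exact: small_ord monC _.
have [g gE] := homogeneous_aut monC sW (Morley_indiscernible (n := n) AM tS).
exists g => l ln; apply/funext => x.
exact: (congr1 (@^~ (inr (Ordinal ln, x))) gE).
Qed.

(** The tail [A] is built over [b] and [b'] together, so that it continues each of them
    separately. *)
Lemma Morley_exists (b b' : 'I_k -> C) :
  (forall psi : formula L ('I_k + M), sat C psi (env_sum b i) ->
     U [set w | sat C psi (env_sum (i \o w) i)]) ->
  elequiv (env_sum i b) (env_sum i b') ->
  exists A : nat -> 'I_k -> C, let pre x l := if l is l'.+1 then A l' else x in
    Morley (pre b) /\ Morley (pre b').
Proof.
move=> UP bb'.
pose W : Type := (M + nat * 'I_k)%type.
(* [nth] pads the finite list with [b], so that one index type [W] serves all stages. *)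
pose d (s : seq ('I_k -> C)) : W -> C := env_sum i (fun x => nth b s x.1 x.2).
have K_lim := monster_strong_limit monC.
have sW : small K W.
  apply: small_sum => //; apply: small_prod => //; last exact: small_ord monC _.
  exact: small_nat monC.
have /choice[nxt nxtP] s := realize_ctype monC (small_ord monC k) sW (coheir_ctype (d s)).
pose st := fix st n := if n is m.+1 then rcons (st m) (nxt (st m)) else [:: b; b'].
have st_size n : size (st n) = n.+2 by elim: n => //= n IH; rewrite size_rcons IH.
have st_nth n l : l < n -> nth b (st n) l.+2 = nxt (st l).
  elim: n => // n IH; rewrite ltnS leq_eqVlt nth_rcons st_size => /orP[/eqP ->|ln].
    by rewrite ltnn eqxx.
  by rewrite 2!ltnS ln IH.
have st0 n : nth b (st n) 0 = b.
  by elim: n => //= n IH; rewrite nth_rcons st_size.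
have st1 n : nth b (st n) 1 = b'.
  by elim: n => //= n IH; rewrite nth_rcons st_size.
exists (fun n => nxt (st n)) => pre.
have M0 x : elequiv (env_sum i b) (env_sum i x) ->
    forall theta, coheir (prefix_env (pre x) 0) theta <-> sat C theta (env_sum x
      (prefix_env (pre x) 0)).
  move=> bx theta.
  pose e0 (y : M + 'I_0 * 'I_k) : M :=
    match y with inl m => m | inr z => let: Ordinal _ h :=
      z.1 in False_rect M (notF (etrans (esym (ltn0 _)) h)) end.
  have e0P : prefix_env (pre x) 0 = i \o e0 by apply/funext => -[//|[[]]].
  have sub psi : sat C psi (env_sum x i) -> coheir i psi.
    move=> h; apply: UP.
    have e : elequiv (env_sum b i) (env_sum x i).
      by apply: (elequiv_sub (f := env_sum inr inl) bx); apply/funext => -[].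
    exact/e.
  rewrite e0P -coheir_reparam -sat_reparam.
  split=> [hc|/sub//]; apply: contrapT => /(sub (FNot _)).
  by rewrite (ctype_FNot (coheir_ctype i)).
(* [y] is the position of [x] in the list [st n], 0 for [b] and 1 for [b']; the terms of [A] start
   at position 2. *)
have MS x (y : bool) : (forall n, nth b (st n) y = x) ->
    forall n theta, coheir (prefix_env (pre x) n.+1) theta <->
      sat C theta (env_sum (pre x n.+1) (prefix_env (pre x) n.+1)).
  move=> stx n theta.
  pose h (z : M + 'I_n.+1 * 'I_k) : W :=
    match z with inl m => inl m | inr z => inr (if z.1 is Ordinal l.+1 _ then l.+2
      else y : nat, z.2) end.
  have hP : prefix_env (pre x) n.+1 = d (st n) \o h.
    apply/funext => -[//|[[[|l] ln] z]] /=; first by rewrite stx.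
    by rewrite st_nth.
  by rewrite hP -coheir_reparam nxtP sat_reparam.
split=> -[|n] theta; [exact: M0|exact: (MS _ false)|exact: M0|exact: (MS _ true)].
Qed.

End Morley.

(** * Invariant measures in NIP theories *)

Section NIPMeasure.
Variables (R : realType) (L : language) (K : Type) (C M : structure L) (J :
  Type) (a : J -> C).
Hypotheses (monC : monster K C) (sM : small K M) (sJ : small K J).
Variables (i : M -> C) (iE : elementary i).
Variable mu : set (set (formula L (J + C))) -> R.
Hypothesis mu_measure : Keisler_measure a mu.
Hypothesis mu_inv : forall (g : aut C) theta,
  mu [set act g p | p in clopen a theta] = mu (clopen a theta).
Hypothesis C_NIP : forall (m n : nat) (phi : formula L ('I_m + 'I_n)), NIP_formula C phi.

Local Notation weight := (weight a mu).
Local Notation holds theta c := (sat C theta (env_sum c id)).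

(** * Alternation of a formula along a Morley sequence *)

Section Alternation.
Variables (k : nat) (phi : formula L (J + 'I_k)).

Definition at_index (l : nat) : formula L (J + nat * 'I_k) :=
  rename (env_sum inl (fun x => inr (l, x))) phi.

Fixpoint alternation (n : nat) : formula L (J + nat * 'I_k) :=
  if n is m.+1
  then FAnd (alternation m) (FAnd (at_index m.*2) (FNot (at_index m.*2.+1)))
  else FNot FFalse.

Definition uncur (A : nat -> 'I_k -> C) (x : nat * 'I_k) : C := A x.1 x.2.

Lemma sat_at_index l c A :
  sat C (at_index l) (env_sum c (uncur A)) = sat C phi (env_sum c (A l)).
Proof. by rewrite /at_index sat_rename env_sum_comp. Qed.

Lemma sat_alternation n c A :
  sat C (alternation n) (env_sum c (uncur A)) <->
  forall l, l < n -> sat C phi (env_sum c (A l.*2)) /\ ~ sat C phi (env_sum c (A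
    l.*2.+1)).
Proof.
elim: n => [|n IH]; first by split=> // _ [].
rewrite [alternation _]/= !sat_FAnd sat_FNot !sat_at_index IH.
split=> [[h h'] l|h].
  by rewrite ltnS leq_eqVlt => /orP[/eqP ->|/h].
by split; [move=> l ln; apply: h; exact: ltnW|exact: h].
Qed.

Lemma holds_alternation n c A :
  holds (reparam (uncur A) (alternation n)) c <->
  forall l, l < n -> sat C phi (env_sum c (A l.*2)) /\ ~ sat C phi (env_sum c (A
    l.*2.+1)).
Proof. by rewrite sat_reparam; exact: sat_alternation. Qed.

Variable U : set_system ('I_k -> M).
Variables (A : nat -> 'I_k -> C).
Hypothesis AM : Morley i U A.

Lemma weight_alternation n t : (forall l, t l < t l.+1) ->
  weight (reparam (uncur (A \o t)) (alternation n)) = weight (reparam (uncur A)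
    (alternation n)).
Proof.
move=> tS; have [g gP] := Morley_aut monC sM n.*2 AM tS.
rewrite -(weight_reparam mu_inv g) reparam_comp.
apply: (weight_eq mu_measure) => c.
rewrite (_ : g \o uncur (A \o t) = uncur (fun l => g \o A (t l))) // !holds_alternation.
split=> h l ln; have [] := h l ln; rewrite !gP //; lia.
Qed.

(** If one more alternation had weight zero, sliding the last alternating pair to the right would
    give infinitely many events of the same positive weight with pairwise null intersections. *)
Lemma alternation_pos n : (0 < weight (reparam (uncur A) (alternation 1)))%R ->
  (0 < weight (reparam (uncur A) (alternation n.+1)))%R.
Proof.
move=> pos1; elim: n => // n IH.
rewrite lt_neqAle weight_ge0 // andbT; apply/negP => /eqP w0.
(* [t m] keeps the first [n] pairs of indices and shifts the later ones by [m] pairs. *)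
pose t m l := if l < n.*2 then l else l + m.*2.
pose E m := reparam (uncur (A \o t m)) (alternation n.+1).
have tS m l : t m l < t m l.+1 by rewrite /t; case: ifP; case: ifP; lia.
suff : (weight (reparam (uncur A) (alternation n.+1)) <= 0)%R by rewrite leNgt IH.
apply: (weight_aedisjoint mu_measure (E := E)).
  by move=> m; exact: weight_alternation.
move=> m m' mm'; apply/le_anti; rewrite weight_ge0 // andbT w0.
(* [t'] lists the first [n] pairs, the last pair of [E m] and then the last pair of [E m']. The
   latter moves from place [n] to place [n.+1], whence [m'.-1]. *)
pose t' l := if l < n.*2 then l else if l < n.*2.+2 then l + m.*2 else l + m'.-1.*2.
have t'S l : t' l < t' l.+1 by rewrite /t'; do 4?case: ifP; lia.
rewrite -(weight_alternation n.+2 t'S); apply: weight_le => // c.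
rewrite sat_FAnd /E !holds_alternation => -[h h'] l ln.
have t1 x : x < n.*2.+2 -> t' x = t m x by rewrite /t /t' => ->.
have t2 x : n.*2 <= x -> t' x.+2 = t m' x.
  by move=> nx; rewrite /t /t'; do 3?case: ifP; lia.
have [l1|l1] := ltnP l n.+1.
  by have := h l l1; rewrite /= !t1 //; lia.
have -> : l = n.+1 by lia.
by have := h' n (ltnSn n); rewrite /= doubleS !t2 //; lia.
Qed.

Lemma alternation_shatters : (0 < weight (reparam (uncur A) (alternation 1)))%R ->
  forall X : set nat, exists c : J -> C, forall l, sat C phi (env_sum c (A l)) <-> X l.
Proof.
move=> pos1 X.
pose x l : bool := `[< X l >].
pose lit l := if x l then at_index l else FNot (at_index l).
have litP l c : sat C (lit l) (env_sum c (uncur A)) <-> (sat C phi (env_sum c (A l))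
  <-> X l).
  by rewrite /lit /x; case: asboolP => Xl; rewrite ?sat_FNot sat_at_index; tauto.
have [||c cP] := @saturated_realize _ _ _ _ _ (uncur A) (range lit) monC sJ _ _.
- by apply: small_prod;
  [exact: monster_strong_limit monC|exact: small_nat monC|exact: small_ord monC _].
- move=> n theta h; pose l z := s2val (cid2 (h z)).
  have lP z : lit (l z) = theta z := s2valP' (cid2 (h z)).
  pose N := (\max_z l z).+1.
  have lN z : l z < N by rewrite ltnS; exact: leq_bigmax.
  (* From the [l]-th pair, take the even index, where [phi] holds, if [l] is in [X], and otherwise
     the odd one, where it fails. Indiscernibility then moves the chosen terms to the first terms of
     [A]. *)
  pose t l := l.*2 + ~~ x l.
  have tS l0 : t l0 < t l0.+1 by rewrite /t; case: (x l0); case: (x l0.+1);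
    rewrite /=; lia.
  have [g gP] := Morley_aut monC sM N AM tS.
  have [c0 /holds_alternation c0P] := weight_pos_sat mu_measure (alternation_pos N pos1).
  exists (g \o c0) => z; rewrite -lP; apply/litP.
  rewrite -(gP _ (lN z)) -env_sum_comp -(elequiv_aut g _ phi).
  have [h1 h2] := c0P (l z) (ltnW (lN z)).
  rewrite /t /x; case: asboolP => Xl; rewrite ?addn0 ?addn1; split=> //.
exists c => l; apply/litP; apply: cP; by exists l.
Qed.

Lemma weight_Morley_diff :
  weight (FAnd (reparam (A 0) phi) (FNot (reparam (A 1) phi))) = 0%R.
Proof.
apply: contrapT => w0.
have pos1 : (0 < weight (reparam (uncur A) (alternation 1)))%R.
  rewrite lt_neqAle weight_ge0 // andbT eq_sym; apply/eqP => w1; apply: w0.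
  rewrite -w1; apply: weight_eq => // c;
    rewrite holds_alternation sat_FAnd sat_FNot !sat_reparam.
  by split=> [h [|//] _|/(_ 0 isT)].
have /choice[c cP] := alternation_shatters pos1.
have [m [f [psi psiE]]] := formula_vars phi.
apply: (@C_NIP k m (rename (env_sum inr inl) psi)).
exists A, (fun X => c X \o f) => l X; rewrite -cP psiE !sat_rename.
rewrite (_ : env_sum (A l) (c X \o f) \o _ = env_sum (c X) (A l) \o env_sum (inl \o
  f) inr) //.
by apply/funext => -[].
Qed.

End Alternation.

(** [A 0] interpolates: the difference is covered by [phi(x, b)] without [phi(x, A 0)] and
    [phi(x, A 0)] without [phi(x, b')]. The second piece comes from the negation of [phi] along the
    sequence that starts with [b']. *)
Lemma weight_diff k (phi : formula L (J + 'I_k)) (b b' : 'I_k -> C) :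
  elequiv (env_sum i b) (env_sum i b') ->
  weight (FAnd (reparam b phi) (FNot (reparam b' phi))) = 0%R.
Proof.
move=> bb'; have [U [UU UP]] := coheir_ultra iE b.
have [A [Mb Mb']] := Morley_exists monC sM UU UP bb'.
have h1 := weight_Morley_diff phi Mb.
have h2 := weight_Morley_diff (FNot phi) Mb'.
apply/le_anti; rewrite weight_ge0 // andbT.
rewrite -[X in (_ <= X)%R]addr0 -{1}h1 -h2; apply: weight_sub => // c.
rewrite !sat_FAnd !sat_FNot !sat_reparam /= => -[hb nb'].
by have [h|h] := pselect (sat C phi (env_sum c (A 0))); [right; split=> // /(_ h)|left].
Qed.

(** The ultrafilter contains every formula whose negation has weight zero, hence none of weight
    zero. As the weight is [Aut(C)]-invariant, [weight_diff] applies to all conjugates of the type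
    at once. *)
Lemma measure_type_exists : exists2 p0, types a p0 & forall g, fixes i (act g p0).
Proof.
have [|U [UU UP]] := @conj_closed_ultra L (J -> C) _
    [set theta | weight (FNot theta) = 0%R] (fun theta => [set c | holds theta c]).
  move=> n theta h.
  have [|c] := @weight_pos_sat _ _ _ _ a mu mu_measure (FConj theta); last first.
    by rewrite sat_FConj; exists c.
  have : weight (FNot (FConj theta)) = 0%R.
    elim: n theta h => [|n IH] theta h.
      by apply: weight_false => // c; rewrite sat_FNot sat_FConj; apply=> -[].
    apply/le_anti; rewrite weight_ge0 // andbT.
    have := @weight_sub _ _ _ _ a mu mu_measure (FNot (FConj theta)) (FNot (theta ord0))
      (FNot (FConj (fun l => theta (lift ord0 l)))).
    rewrite IH ?(h ord0) ?addr0; last by move=> l; exact: h.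
    apply=> c; rewrite sat_FNot => hc.
    have [h0|] := pselect (holds (theta ord0) c); last by left.
    by right; rewrite sat_FNot sat_FConj => h'; apply: hc; rewrite sat_FConj => l;
      case: (unliftP ord0 l) => [l'|] ->.
  move=> w0; rewrite lt_neqAle weight_ge0 // andbT eq_sym; apply/eqP => w1.
  have := @weight_add _ _ _ _ a mu mu_measure (FNot FFalse) (FConj theta) (FNot
    (FConj theta)).
  rewrite w0 w1 addr0 (weight_true mu_measure); last by move=> c [].
  move=> H; have /eqP : 1%R = 0%R :> R by apply: H => c; [split=> _;
    [exact: lem|case]|move=> hc; exact].
  by rewrite oner_eq0.
pose p0 : set (formula L (J + C)) := [set theta | U [set c | holds theta c]].
have p0T : ctype id p0 := ctype_ultra id id UU.
have p0w theta : p0 theta -> weight theta <> 0%R.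
  move=> pt w0; have : p0 (FNot theta).
    apply: UP; rewrite /mkset -w0; apply: weight_eq => // c; rewrite !sat_FNot.
    by split=> [/contrapT|h /(_ h)].
  by move/(ctype_FNot p0T).
exists p0.
  apply/typesE; split=> // phi sphi; apply: UP; rewrite /mkset.
  apply: weight_clopen0 => //; apply/seteqP; split=> // p [/typesE[pT pa]].
  by move/(ctype_FNot pT); apply; exact: pa.
move=> g h hi; apply: funext => theta; apply/propext.
have key k (phi : formula L (J + 'I_k)) b b' : elequiv (env_sum i b) (env_sum i b') ->
    p0 (reparam (aut_invfun g \o b) phi) -> p0 (reparam (aut_invfun g \o b') phi).
  move=> bb' pb; apply: contrapT => /(ctype_FNot p0T) nb'.
  have /(ctype_FAnd p0T)/p0w : p0 (reparam (aut_inv g) (reparam b phi)) /\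
      p0 (FNot (reparam (aut_inv g) (reparam b' phi))).
    by rewrite !reparam_comp.
  apply; rewrite -(weight_diff phi bb') -[RHS](weight_reparam mu_inv (aut_inv g)).
  by [].
have [c0] := carrier_inhabited C.
have [k [b [phi ->]]] := formula_params c0 theta.
rewrite !act_reparam.
have hb : elequiv (env_sum i (aut_invfun h \o b)) (env_sum i b).
  have := elequiv_aut h (env_sum i (aut_invfun h \o b)).
  rewrite env_sum_comp hi (_ : h \o (aut_invfun h \o b) = b) //.
  by apply/funext => l /=; rewrite aut_invfunK.
split; first exact: key.
exact: (key _ _ _ _ (elequiv_sym hb)).
Qed.

End NIPMeasure.

(** * From types in the variables of m to types in the variables of n *)

Section Lift.
Variables (L : language) (C M : structure L) (J I : Type).
Variables (i : M -> C) (iE : elementary i) (e : M -> J).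
Variable b : J -> C.
Hypothesis bE : b \o e = i.

(* Realizes the type of [a] over a copy of [M] which realizes [p0]. *)
Lemma fixes_extend (p0 : set (formula L (J + C))) (a : I -> C) :
  types b p0 -> (forall g, fixes i (act g p0)) ->
  exists2 p : set (formula L (I + C)), types a p & forall g, fixes i (act g p).
Proof.
move=> /typesE[p0T p0b] p0i.
have [U [UU UP]] := coheir_ultra iE a.
pose sub (w : I -> M) : I + C -> J + C := env_sum (inl \o e \o w) inr.
pose ext (q : set (formula L (J + C))) : set (formula L (I + C)) :=
  [set theta | U [set w | q (rename (sub w) theta)]].
(* [sub w] leaves the parameters alone, so the construction commutes with automorphisms and inherits
   the invariance of every conjugate. *)
have extP g : act g (ext p0) = ext (act g p0).
  apply/funext => theta; rewrite /act /ext /mkset; congr U; apply/funext => w.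
  rewrite /mkset /reparam !rename_comp; congr p0; congr rename.
  by apply/funext => -[].
exists (ext p0); last by move=> g h hi;
  rewrite extP -[in RHS](p0i g h hi) !act_mul -!extP act_mul.
apply/typesE; split; first split.
- move=> n theta h.
  have /filter_ex[w wP] : U [set w | forall l, p0 (rename (sub w) (theta l))].
    elim: n theta h => [|n IH] theta h; first by apply: filterS filterT => w _ [].
    apply: filterS (filterI (h ord0) (IH (fun l => theta (lift ord0 l)) (fun l => h _))).
    by move=> w [h0 h1] l; case: (unliftP ord0 l) => [l'|] ->.
  have [c cP] := p0T.1 _ _ wP.
  exists (c \o e \o w) => l; have := cP l; rewrite sat_rename.
  by rewrite /sub env_sum_comp.
- move=> theta; have [|h] :=
  @in_ultra_setVsetC _ U [set w | p0 (rename (sub w) theta)] UU.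
    by left.
  by right; apply: filterS h => w; rewrite /setC /mkset => /(ctype_FNot p0T).
- move=> phi aphi.
  have /UP : sat C (rename inl phi) (env_sum a i) by rewrite sat_rename.
  apply: filterS => w; rewrite /mkset sat_rename => h.
  have := p0b (rename (e \o w) phi); rewrite sat_rename compA bE !rename_comp.
  exact.
Qed.

End Lift.

(** * Kim-Pillay strong automorphisms *)

Section KimPillay.
Variables (L : language) (K K' : Type) (C C' M : structure L).
Hypotheses (monC : monster K C) (monC' : monster K' C').
Variables (j : C -> C') (jE : elementary j).
Variables (I : Type) (a : I -> C) (s : M -> I).
Hypotheses (sI : small K I) (sI' : small K' I) (sC : small K' C) (sM : small K M).
Local Notation i := (a \o s).
Hypothesis iE : elementary i.

Local Notation S := (inv_types a (range i)).
Local Notation op := (star j a (range i)).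
Local Notation fgen := (fGen K a (range i)).

Variable u : set (formula L (I + C)).
Hypothesis uF : fgen u.

Let K_lim := monster_strong_limit monC.
Let uS : S u := fGen_inv uF.
Let uT : ctype id u. Proof. by have /typesE[] := uS.1. Qed.

Definition orbit_stabilizer : set (aut C) :=
  [set h | forall f : aut C, act h (act f u) = act f u].
Local Notation H := orbit_stabilizer.

(** Every type in the orbit is invariant over [g M], because its image under [g^-1] is again in the
    orbit and so [M]-invariant. *)
Lemma stabilizer_fixes_model (h g : aut C) : h \o (g \o a) = g \o a -> H h.
Proof.
move=> hga f.
have fi : fixes i (act (aut_inv g) (act f u)).
  rewrite act_mul; have /(fGenP monC sM iE)/(_ (aut_mul (aut_inv g) f))[_] := uF.
  by move/invariantE.
apply: (fixes_conj fi).
by apply/funext => x; exact: (congr1 (@^~ (s x)) hga).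
Qed.

Lemma stabilizer_one : H (aut_one C).
Proof. by move=> f; exact: act_one. Qed.

Lemma stabilizer_mul h h' : H h -> H h' -> H (aut_mul h h').
Proof. by move=> hH hH' f; rewrite -act_mul hH'. Qed.

Lemma stabilizer_inv h : H h -> H (aut_inv h).
Proof. by move=> hH f; rewrite -{1}(hH f) actK. Qed.

(* [c] realizes [u] over [a] and [h a]; as [h] fixes [u], these two tuples have
   the same type over [c]. *)
Lemma stabilizer_split h : H h ->
  exists c : I -> C, elequiv c a /\ elequiv (env_sum c a) (env_sum c (h \o a)).
Proof.
move=> hH; pose d := env_sum a (h \o a).
have [c cP] := realize_ctype monC sI (small_sum K_lim sI sI) (ctype_reparam uT d).
exists c; split.
  apply: elequiv_sym; apply: elequiv_imp => phi aphi.
  have /typesE[_ ua] := uS.1.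
  have /cP : u (reparam d (rename inl phi)).
    by rewrite /reparam rename_comp; exact: ua.
  by rewrite sat_rename.
move=> phi.
have E1 : sat C phi (env_sum c a) <-> u (reparam a phi).
  have := cP (reparam inl phi); rewrite /mkset sat_reparam reparam_comp => <-.
  by [].
have E2 : sat C phi (env_sum c (h \o a)) <-> u (reparam (h \o a) phi).
  have := cP (reparam inr phi); rewrite /mkset sat_reparam reparam_comp => <-.
  by [].
rewrite E1 E2 -[in X in _ <-> X](act_one u) -(hH (aut_one C)) act_one act_reparam.
rewrite (_ : aut_invfun h \o (h \o a) = a) //.
by apply/funext => x /=; rewrite aut_funK.
Qed.

(** These define the least type-definable relation over the empty set that contains [H]-conjugacy;
    [stabilizer_formulasP] shows that it adds no pairs. *)
Definition stabilizer_formulas : set (formula L (I + I)) :=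
  [set phi | forall (x : I -> C) h, H h -> sat C phi (env_sum x (h \o x))].
Local Notation Phi := stabilizer_formulas.

(** Witnesses that [y] arises from [x] by an automorphism fixing [z] followed by one fixing [c],
    where [z] and [c] are copies of [a]. They are subject to conditions on formulas only, as
    saturation requires. *)
Definition two_step (z c t x y : I -> C) : Prop :=
  [/\ elequiv a z, elequiv a c, elequiv (env_sum z x) (env_sum z t)
    & elequiv (env_sum c t) (env_sum c y)].

(** With [f] fixing [c] and agreeing with [h] on [a], write [h] as [f] after [f^-1 h]; the latter
    fixes [a]. *)
Lemma stabilizer_two_step x h : H h -> exists z c t, two_step z c t x (h \o x).
Proof.
move=> hH; have [c [ca e]] := stabilizer_split hH.
have [f fE] := homogeneous_aut monC (small_sum K_lim sI sI) e.
have fc : f \o c = c by apply/funext => l; exact: (congr1 (@^~ (inl l)) fE).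
have fa : f \o a = h \o a by apply/funext => l; exact: (congr1 (@^~ (inr l)) fE).
pose g := aut_mul (aut_inv f) h.
have ga : g \o a = a.
  by apply/funext => l /=; have /= <- := congr1 (@^~ l) fa; rewrite aut_funK.
exists a, c, (g \o x); split=> //; first exact: elequiv_sym.
  by have := elequiv_aut g (env_sum a x); rewrite env_sum_comp ga.
have := elequiv_aut f (env_sum c (g \o x)); rewrite env_sum_comp fc.
rewrite (_ : f \o (g \o x) = h \o x) //.
by apply/funext => l /=; rewrite aut_invfunK.
Qed.

Lemma two_step_stabilizer z c t x y : two_step z c t x y -> exists2 h, H h & h \o x = y.
Proof.
move=> [az ac zt cy].
have sII := small_sum K_lim sI sI.
have [g1 g1E] := homogeneous_aut monC sII zt.
have [g2 g2E] := homogeneous_aut monC sII cy.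
have [f1 f1E] := homogeneous_aut monC sI az.
have [f2 f2E] := homogeneous_aut monC sI ac.
exists (aut_mul g2 g1).
  apply: stabilizer_mul.
    apply: (stabilizer_fixes_model (g := f2)); rewrite f2E.
    by apply/funext => l; exact: (congr1 (@^~ (inl l)) g2E).
  apply: (stabilizer_fixes_model (g := f1)); rewrite f1E.
  by apply/funext => l; exact: (congr1 (@^~ (inl l)) g1E).
apply/funext => l /=; have /= -> := congr1 (@^~ (inr l)) g1E.
exact: (congr1 (@^~ (inr l)) g2E).
Qed.

(** Finitely many conditions on the witnesses, once these are quantified away, hold on [H]-conjugate
    pairs and so belong to [Phi]; saturation then produces the witnesses. *)
Lemma stabilizer_formulasP (x y : I -> C) :
  type_definable_rel Phi x y <-> exists2 h, H h & h \o x = y.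
Proof.
split=> [xy|[h hH <-] phi]; last exact.
pose env z c t x y : (I + I + I) + (I + I) -> C :=
  env_sum (env_sum (env_sum z c) t) (env_sum x y).
pose Sigma : set (formula L ((I + I + I) + (I + I))) :=
  [set chi | forall z c t x y, two_step z c t x y -> sat C chi (env z c t x y)].
have sII := small_sum K_lim sI sI.
have [|v vP] := @saturated_realize _ _ _ _ _ (env_sum x y) Sigma monC (small_sum
  K_lim sII sI) sII.
  move=> n theta thS; have [psi psiP] := ex_quant_family theta.
  apply/psiP; apply: xy => x' h hH; apply/psiP.
  have [z [c [t zct]]] := stabilizer_two_step x' hH.
  by exists (env_sum (env_sum z c) t) => l; exact: thS.
pose z := v \o inl \o inl; pose c := v \o inl \o inr; pose t := v \o inr.
have vE : env_sum v (env_sum x y) = env z c t x y.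
  by apply/funext => -[[[]|]|[]].
rewrite vE in vP.
apply: (@two_step_stabilizer z c t); split.
- apply: elequiv_imp => phi aphi.
  have /vP : Sigma (rename (inl \o inl \o inl) phi).
    by move=> z' c' t' x' y' [+ _ _ _] => /(_ phi) e; rewrite sat_rename; apply/e.
  by rewrite sat_rename.
- apply: elequiv_imp => phi aphi.
  have /vP : Sigma (rename (inl \o inl \o inr) phi).
    by move=> z' c' t' x' y' [_ + _ _] => /(_ phi) e; rewrite sat_rename; apply/e.
  by rewrite sat_rename.
- apply: elequiv_imp => phi.
  pose r1 : I + I -> (I + I + I) + (I + I) := env_sum (inl \o inl \o inl) (inr \o inl).
  pose r2 : I + I -> (I + I + I) + (I + I) := env_sum (inl \o inl \o inl) (inl \o inr).
  have r1P z' c' t' x' y' :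
    env z' c' t' x' y' \o r1 = env_sum z' x' by apply/funext => -[].
  have r2P z' c' t' x' y' :
    env z' c' t' x' y' \o r2 = env_sum z' t' by apply/funext => -[].
  have /vP : Sigma (FImp (rename r1 phi) (rename r2 phi)).
    move=> z' c' t' x' y' [_ _ + _] => /(_ phi) e.
    by rewrite /= !sat_rename r1P r2P; apply e.
  by rewrite /= !sat_rename r1P r2P.
- apply: elequiv_imp => phi.
  pose r1 : I + I -> (I + I + I) + (I + I) := env_sum (inl \o inl \o inr) (inl \o inr).
  pose r2 : I + I -> (I + I + I) + (I + I) := env_sum (inl \o inl \o inr) (inr \o inr).
  have r1P z' c' t' x' y' :
    env z' c' t' x' y' \o r1 = env_sum c' t' by apply/funext => -[].
  have r2P z' c' t' x' y' :
    env z' c' t' x' y' \o r2 = env_sum c' y' by apply/funext => -[].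
  have /vP : Sigma (FImp (rename r1 phi) (rename r2 phi)).
    move=> z' c' t' x' y' [_ _ _ +] => /(_ phi) e.
    by rewrite /= !sat_rename r1P r2P; apply e.
  by rewrite /= !sat_rename r1P r2P.
Qed.

Lemma type_definable_rel_elequiv (A B : structure L) (x y : I -> A) (x' y' : I -> B) :
  elequiv (env_sum x y) (env_sum x' y') ->
  type_definable_rel Phi x y -> type_definable_rel Phi x' y'.
Proof. by move=> e xy phi /xy/e. Qed.

(** Each axiom concerns at most three tuples of [C']. They are pulled back to [C], where the
    relation is conjugacy under the group [H]. *)
Lemma stabilizer_equivalence :
  RelationClasses.Equivalence (@type_definable_rel L C' I Phi).
Proof.
have sII := small_sum K_lim sI sI.
split.
- move=> x.
  have [x0 x0P] := pull_back x a monC sI sI jE.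
  apply: (@type_definable_rel_elequiv C C' x0 x0).
    by apply: (elequiv_sub (f := env_sum inl inl) x0P); apply/funext => -[].
  by apply/stabilizer_formulasP; exists (aut_one C) => //; exact: stabilizer_one.
- move=> x y xy.
  have [v vP] := pull_back (env_sum x y) a monC sII sI jE.
  have e1 : elequiv (env_sum (v \o inl) (v \o inr)) (env_sum x y).
    by apply: (elequiv_sub (f := inl) vP); apply/funext => -[].
  have e2 : elequiv (env_sum (v \o inr) (v \o inl)) (env_sum y x).
    by apply: (elequiv_sub (f :=
      env_sum (inl \o inr) (inl \o inl)) vP); apply/funext => -[].
  apply: (type_definable_rel_elequiv e2).
  have /stabilizer_formulasP[h hH hE] := type_definable_rel_elequiv (elequiv_sym e1) xy.
  apply/stabilizer_formulasP; exists (aut_inv h); first exact: stabilizer_inv.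
  by rewrite -hE; apply/funext => l /=; rewrite aut_funK.
- move=> x y z xy yz.
  have [v vP] := pull_back (env_sum (env_sum x y) z) a monC (small_sum K_lim sII sI)
    sI jE.
  have e1 : elequiv (env_sum (v \o inl \o inl) (v \o inl \o inr)) (env_sum x y).
    by apply: (elequiv_sub (f := inl \o inl) vP); apply/funext => -[].
  have e2 : elequiv (env_sum (v \o inl \o inr) (v \o inr)) (env_sum y z).
    by apply: (elequiv_sub (f :=
      env_sum (inl \o inl \o inr) (inl \o inr)) vP); apply/funext => -[].
  have e3 : elequiv (env_sum (v \o inl \o inl) (v \o inr)) (env_sum x z).
    by apply: (elequiv_sub (f :=
      env_sum (inl \o inl \o inl) (inl \o inr)) vP); apply/funext => -[].
  apply: (type_definable_rel_elequiv e3).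
  have /stabilizer_formulasP[h hH hE] := type_definable_rel_elequiv (elequiv_sym e1) xy.
  have /stabilizer_formulasP[h' hH' hE'] :=
    type_definable_rel_elequiv (elequiv_sym e2) yz.
  apply/stabilizer_formulasP; exists (aut_mul h' h); first exact: stabilizer_mul.
  by rewrite -hE' -hE.
Qed.

(** A class is determined by the type of a representative over [j \o a]: two tuples with the same
    type have copies in [C] that are conjugate under an automorphism fixing [a], which lies in
    [H]. *)
Lemma stabilizer_bounded : bounded_rel K' (@type_definable_rel L C' I Phi).
Proof.
have [RR RS RT] := stabilizer_equivalence.
have K'_lim := monster_strong_limit monC'.
have [m0] := carrier_inhabited M.
have sF := small_set K'_lim (small_formula monC' (inhabits (inl (s m0) :
  I + I)) (small_sum K'_lim sI' sI')).
apply/card_lt_small.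
set classes := (X in small _ X).
have /choice[rep repP] (cl : classes) : exists x : I ->
  C', [set y | type_definable_rel Phi x y] = val cl.
  by have [x _ <-] := set_valP cl; exists x.
pose tpa (cl : classes) : set (formula L (I + I)) :=
  [set psi | sat C' psi (env_sum (j \o a) (rep cl))].
apply: small_inj sF; apply: (_ : injective tpa) => cl cl' e.
apply: val_inj; rewrite -!repP.
suff xy : type_definable_rel Phi (rep cl) (rep cl').
  by apply/seteqP; split=> y /= h; apply: RT h => //; exact: RS.
have sII := small_sum K_lim sI sI.
have [v vP] := pull_back (env_sum (rep cl) (rep cl')) a monC sII sI jE.
apply: (@type_definable_rel_elequiv C C' (v \o inl) (v \o inr)).
  by apply: (elequiv_sub (f := inl) vP); apply/funext => -[].
have e1 : elequiv (env_sum a (v \o inl)) (env_sum (j \o a) (rep cl)).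
  by apply: (elequiv_sub (f := env_sum inr (inl \o inl)) vP); apply/funext => -[].
have e2 : elequiv (env_sum a (v \o inr)) (env_sum (j \o a) (rep cl')).
  by apply: (elequiv_sub (f := env_sum inr (inl \o inr)) vP); apply/funext => -[].
have e3 : elequiv (env_sum (j \o a) (rep cl)) (env_sum (j \o a) (rep cl')).
  by move=> psi; have := congr1 (fun F : set (formula L (I + I)) => F psi) e;
    rewrite /tpa /mkset => ->.
have [g gE] := homogeneous_aut monC sII (elequiv_trans e1 (elequiv_trans e3
  (elequiv_sym e2))).
apply/stabilizer_formulasP; exists g; last first.
  by apply/funext => l; exact: (congr1 (@^~ (inr l)) gE).
apply: (stabilizer_fixes_model (g := aut_one C)).
by apply/funext => l; exact: (congr1 (@^~ (inl l)) gE).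
Qed.

(** For each finite [b], the realizations of [p] and [q] are copied to [C] over [b] as [g1 \o a] and
    [g2 \o a], which are [H]-conjugate. The two products are [g1 u] and [g2 u] at [b], and [H] does
    not change [g1 u]. *)
Lemma star_KP p q (sigma tau gamma : aut C') : types a p -> types a q ->
  p = tp j a sigma -> q = tp j a tau ->
  Autf_KP K' C' gamma -> tau =1 gamma \o sigma -> op u p = op u q.
Proof.
move=> pT qT pE qE gKP st.
pose x := sigma \o j \o a; pose y := tau \o j \o a.
have xy : type_definable_rel Phi x y.
  have -> : y = gamma \o x by apply/funext => l; exact: st.
  exact: gKP sI' _ stabilizer_equivalence stabilizer_bounded x.
have sII := small_sum K_lim sI sI.
apply: type_ext => k phi b; have sk := small_ord monC k.
have [v vP] := pull_back (env_sum x y) b monC sII sk jE.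
pose x0 := v \o inl; pose y0 := v \o inr.
have exy : elequiv (env_sum x0 y0) (env_sum x y).
  by apply: (elequiv_sub (f := inl) vP); apply/funext => -[].
have /stabilizer_formulasP[h hH hE] := type_definable_rel_elequiv (elequiv_sym exy) xy.
have exb : elequiv (env_sum x0 b) (env_sum x (j \o b)).
  by apply: (elequiv_sub (f := env_sum (inl \o inl) inr) vP); apply/funext => -[].
have eyb : elequiv (env_sum y0 b) (env_sum y (j \o b)).
  by apply: (elequiv_sub (f := env_sum (inl \o inr) inr) vP); apply/funext => -[].
have main r rho w w0 : types a r -> r = tp j a rho -> w = rho \o j \o a ->
    elequiv (env_sum w0 b) (env_sum w (j \o b)) ->
    exists2 g : aut C, g \o a = w0 & op u r (reparam b phi) <-> act g u (reparam b phi).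
  move=> rT rE wE e; have [b1 b1P] := link_ex monC sI b rT sk.
  have e1 : elequiv (env_sum a b1) (env_sum w0 b).
    by move: b1P; rewrite rE link_tp -wE => h1; exact: elequiv_trans (elequiv_sym e).
  have [g gE] := homogeneous_aut monC sI (elequiv_comp inl e1).
  exists g => //.
  rewrite (star_spec monC monC' jE sI sI' sC sM phi uS rT b1P) act_reparam.
  apply: (inv_type_elequiv monC sI uS phi sk).
  apply: (elequiv_trans e1); have := elequiv_aut (aut_inv g) (env_sum w0 b).
  rewrite env_sum_comp (_ : aut_inv g \o w0 = a) //.
  by rewrite -[w0]/(env_sum w0 b \o inl) -gE; apply/funext => l /=; rewrite aut_funK.
have [g1 g1E ->] := main _ _ _ _ pT pE erefl exb.
have [g2 g2E ->] := main _ _ _ _ qT qE erefl eyb.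
suff -> : act g1 u = act g2 u by [].
rewrite -(hH g1).
have /inv_typesE[_ ui] := uS.
have /ui : aut_mul (aut_inv g2) (aut_mul h g1) \o i = i.
  apply/funext => l /=.
  have /= -> := congr1 (@^~ (s l)) g1E.
  have /= -> := congr1 (@^~ (s l)) hE.
  by have /= <- := congr1 (@^~ (s l)) g2E; rewrite aut_funK.
by rewrite -!act_mul => /(congr1 (act g2)); rewrite actVK.
Qed.

Lemma rho_injective p q : op u u = u -> orbit_type u p -> orbit_type u q ->
  rho j a (Autf_KP K' C') p = rho j a (Autf_KP K' C') q -> p = q.
Proof.
move=> uu up uq pq.
have pT : types a p by have [] := fGen_inv (fGen_orbit monC sM iE uF up).
have qT : types a q by have [] := fGen_inv (fGen_orbit monC sM iE uF uq).
have id1 := idempotent_star monC monC' jE sI sI' sC sM uF uu.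
rewrite -(id1 _ up) -(id1 _ uq).
set sigma := realizer j a p in pq; set tau := realizer j a q in pq.
have KP1 : Autf_KP K' C' (aut_one C').
  by move=> X _ Psi [refl _ _] _ x; exact: refl.
(* Equal cosets put [sigma^-1] into [tau^-1 Autf_KP], so that [tau] is [gamma] after [sigma] for a
   strong [gamma]. *)
have : rho j a (Autf_KP K' C') p (aut_mul (aut_inv sigma) (aut_one C')).
  by exists (aut_one C').
rewrite pq => -[gamma gKP gE].
apply: (star_KP (sigma := sigma) (tau := tau) (gamma := gamma)) => //.
- exact: (realizerP monC' jE sI' sC).
- exact: (realizerP monC' jE sI' sC).
- move=> x; have := congr1 (fun f : aut C' => f (sigma x)) gE.
  by rewrite /= aut_funK => /(congr1 tau); rewrite aut_invfunK => ->.
Qed.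

End KimPillay.

(** * Specialization to the enumerations of M and N *)

Unset Implicit Arguments.

Theorem theorem4p10
    (R : realType) (L : language) (T : set (sentence L))
    (T_complete : complete_theory T)
    (K K' : Type) (C C' : structure L)
    (C_model : models C T)
    (C_monster : monster K C) (C'_monster : monster K' C')
    (C'_larger : small K' C)
    (j : C -> C') (j_elementary : elementary j)
    (M N : structure L) (M_small : small K M) (N_small : small K N)
    (iM : M -> N) (iM_elementary : elementary iM)
    (iN : N -> C) (iN_elementary : elementary iN)
    (J I : Type) (m : J -> M) (n : I -> N) (e : J -> I)
    (m_enum : bijective m) (n_enum : bijective n)
    (m_sub_n : forall i, iM (m i) = n (e i))
    (T_amenable : amenable R (iN \o iM \o m))
    (T_NIP : NIP T) :
  let nC : I -> C := iN \o n in
  let MC : set C := range (iN \o iM) in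
  let S : set (set (formula L (I + C))) := inv_types nC MC in
  let op := star j nC MC in
  let fgen : set (set (formula L (I + C))) := fGen K nC MC in
  [/\ two_sided_ideal S op fgen,
      forall p, fgen p ->
        [/\ [set op p q | q in S] = orbit_type p,
            Ellis_group S op [set op p q | q in S]
          & minimal_right_ideal S op [set op p q | q in S]],
      minimal_left_ideal S op fgen /\
        (forall F, minimal_left_ideal S op F -> F = fgen),
      forall E : set (set (formula L (I + C))),
        Ellis_group S op E <-> exists2 p, fgen p & E = orbit_type p
    & forall E : set (set (formula L (I + C))), Ellis_group S op E ->
        forall p q, E p -> E q ->
          rho j nC (Autf_KP K' C') p = rho j nC (Autf_KP K' C') q -> p = q].
Proof.
have iE : elementary (iN \o iM) := elementary_comp iM_elementary iN_elementary.
have [m' mK m'K] := m_enum; have [n' nK n'K] := n_enum.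
have sI : small K I := small_inj (bij_inj n_enum) N_small.
have sJ : small K J := small_inj (bij_inj m_enum) M_small.
have sI' : small K' I.
  apply: (small_inj (f := iN \o n)) C'_larger.
  exact: inj_comp (elementary_inj iN_elementary) (bij_inj n_enum).
(* Invariance over [M] is expressed through a subtuple of [n], indexed by [M] itself. *)
pose s : M -> I := n' \o iM.
have si : iN \o iM = (iN \o n) \o s.
  by apply: funext => x; rewrite /s /= n'K.
have bm : (iN \o iM \o m) \o m' = iN \o iM.
  by apply: funext => x; rewrite /= m'K.
have C_NIP : forall (m0 n0 : nat) (phi : formula L ('I_m0 + 'I_n0)), NIP_formula C phi.
  exact: T_NIP.
have [mu [mu_measure mu_inv]] := T_amenable.
have [p0 p0T p0i] := measure_type_exists C_monster M_small sJ iE mu_measure mu_inv C_NIP.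
have [p pT pi] := fixes_extend iE bm (iN \o n) p0T p0i.
move=> nC MC S op fgen.
rewrite /S /op /fgen /MC; move=> {S op fgen MC}.
rewrite si; rewrite si in iE pi.
have fgen0 : fGen K nC (range (nC \o s)) !=set0.
  exists p; apply/(fGenP C_monster M_small iE) => g; apply/inv_typesE; split=> //.
  exact: act_types.
split.
- exact: (fGen_two_sided C_monster C'_monster j_elementary sI sI' C'_larger M_small iE).
- move=> q qF.
  rewrite (star_orbit C_monster C'_monster j_elementary sI sI' C'_larger M_small iE qF).
  split=> //.
    apply/(Ellis_groupP C_monster C'_monster j_elementary sI sI' C'_larger M_small iE
      _ fgen0).
    by exists q.
  exact: (orbit_minimal_right C_monster C'_monster j_elementary sI sI' C'_larger
    M_small iE).
- split; first exact: (fGen_minimal C_monster C'_monster j_elementary sI sI'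
  C'_larger M_small iE fgen0).
  move=> F; exact: (minimal_left_unique C_monster C'_monster j_elementary sI sI'
    C'_larger M_small iE fgen0).
- move=> E.
  exact: (Ellis_groupP C_monster C'_monster j_elementary sI sI' C'_larger M_small iE
    E fgen0).
- move=> E [F [u [Fmin Fu uu EE]]].
  have FE := minimal_left_unique C_monster C'_monster j_elementary sI sI' C'_larger
    M_small iE fgen0 Fmin.
  rewrite FE in Fu EE; rewrite EE.
  rewrite (idempotent_orbit C_monster C'_monster j_elementary sI sI' C'_larger
    M_small iE Fu uu).
  move=> q r uq ur.
  exact: (rho_injective C_monster C'_monster j_elementary sI sI' C'_larger M_small iE
    Fu uu uq ur).
Qed.
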